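(* Let $\Bbbk$ be a field of characteristic zero. Let $L$ be the graded Lie algebra over $\Bbbk$ generated by symbols $d$, $a_i$, $b_i$ ($i\ge1$), of homological degrees $|d|=|a_i|=-1$, $|b_i|=0$, subject to the relations $[b_n,d]=a_n-\sum_{i+j=n,\ i,j\ge1}\frac{i}{i+j}[b_i,a_j]$ for $n\ge1$, with the weight grading $w(a_i)=w(b_i)=i$, $w(d)=0$, and let $\widehat U$ be the completion with respect to $w$ of the universal enveloping algebra of $L$. Put $f_i=i\,b_i$, $\beta=\sum_{i\ge1}b_i$, and \[ \xi=\sum_{n=1}^\infty\ \sum_{i_1,\dots,i_n\ge 1}\left[\frac1n\sum_{\substack{\rho\in S_n\\ \rho(1)=1}}\frac{(-1)^{\mathsf d(\rho^{-1})}}{\binom{n-1}{\mathsf d(\rho^{-1})}}\prod_{j=1}^{n}\frac{1}{i_{\rho(1)}+\cdots+i_{\rho(j)}}\right]\operatorname{ad}_{f_{i_n}}\cdots\operatorname{ad}_{f_{i_2}}(f_{i_1}). \] Then, in $\widehat U$, \[ \xi=\log\Big(1+\sum_{k\ge1}\beta^{\prec k}\Big). \]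
   Context: $\widehat U$ is the product of the weight components of the universal enveloping algebra. On weight-homogeneous elements of positive weight, $u\prec v=\frac{w(u)}{w(u)+w(v)}uv$, extended bilinearly and continuously; $\beta^{\prec1}=\beta$ and $\beta^{\prec(n+1)}=\beta\prec\beta^{\prec n}$. $\operatorname{ad}_x=[x,-]$. $\mathsf d(\tau)$ is the number of descents of $\tau\in S_n$, i.e. the number of $1\le k\le n-1$ with $\tau(k)>\tau(k+1)$. $\log(1+u)=\sum_{n\ge1}\frac{(-1)^{n-1}}{n}u^n$ for the associative product of $\widehat U$. *)

(* Defs.v *)
From HB Require Import structures.
From mathcomp Require Import all_boot all_order all_fingroup all_algebra.
From mathcomp Require Import boolp classical_sets cardinality fsbigop.
From mathcomp Require Import finmap monalg.

Set Implicit Arguments.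
Unset Strict Implicit.
Unset Printing Implicit Defensive.

Import GRing.Theory.

Local Open Scope ring_scope.
Local Open Scope quotient_scope.
Local Open Scope classical_set_scope.

(** [A] is a vector space with a product [op]; [quoalg op R] is the quotient
    of [A] by the two-sided ideal generated by the relators [R]. *)

Section IdealQuotient.
Variables (k : fieldType) (A : lmodType k) (op : A -> A -> A) (R : A -> Prop).

Inductive gen_ideal : A -> Prop :=
| gen_ideal_rel x : R x -> gen_ideal x
| gen_ideal0 : gen_ideal 0
| gen_idealD x y : gen_ideal x -> gen_ideal y -> gen_ideal (x + y)
| gen_idealZ c x : gen_ideal x -> gen_ideal (c *: x)
| gen_idealMl x y : gen_ideal y -> gen_ideal (op x y)
| gen_idealMr x y : gen_ideal x -> gen_ideal (op x y).

Definition in_ideal (x : A) : bool := `[< gen_ideal x >].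

Lemma in_idealP x : reflect (gen_ideal x) (x \in in_ideal).
Proof. exact: asboolP. Qed.

Lemma in_ideal_zmod_closed : zmod_closed in_ideal.
Proof.
split=> [|x y /in_idealP Ix /in_idealP Iy]; apply/in_idealP.
  exact: gen_ideal0.
by apply: gen_idealD => //; rewrite -scaleN1r; apply: gen_idealZ.
Qed.

HB.instance Definition _ := GRing.isZmodClosed.Build A in_ideal
  in_ideal_zmod_closed.

Definition ideal_zmod := GRing.ZmodClosed.clone A in_ideal _.

Definition quoalg := Quotient.quot ideal_zmod.

HB.instance Definition _ := GRing.Zmodule.on quoalg.

Definition quopi (x : A) : quoalg := \pi_(Quotient.quot ideal_zmod) x.
Definition quorepr (x : quoalg) : A := generic_quotient.repr (x : Quotient.quot ideal_zmod).

Lemma quoreprK x : quopi (quorepr x) = x.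
Proof. exact: reprK. Qed.

Lemma eq_quopi x y : quopi x = quopi y <-> gen_ideal (x - y).
Proof.
split=> [/eqP|H]; first by rewrite -Quotient.idealrBE => /in_idealP.
by apply/eqP; rewrite -Quotient.idealrBE; apply/in_idealP.
Qed.

Lemma quopi_zmod_morphism : zmod_morphism quopi.
Proof. by move=> x y; rewrite /quopi raddfB. Qed.

HB.instance Definition _ := GRing.isZmodMorphism.Build A quoalg quopi
  quopi_zmod_morphism.

Definition quoscale (c : k) (x : quoalg) : quoalg := quopi (c *: quorepr x).

Lemma quopiZ c x : quoscale c (quopi x) = quopi (c *: x).
Proof.
by apply/eq_quopi; rewrite -scalerBr; apply/gen_idealZ/eq_quopi/quoreprK.
Qed.

Lemma quoscaleA a b x : quoscale a (quoscale b x) = quoscale (a * b) x.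
Proof. by rewrite -(quoreprK x) !quopiZ scalerA. Qed.

Lemma quoscale1 : left_id 1 quoscale.
Proof. by move=> x; rewrite -(quoreprK x) !quopiZ scale1r. Qed.

Lemma quoscaleDr : right_distributive quoscale +%R.
Proof.
move=> c x y; rewrite -(quoreprK x) -(quoreprK y).
by rewrite -raddfD !quopiZ scalerDr raddfD.
Qed.

Lemma quoscaleDl x : {morph quoscale^~ x : a b / a + b}.
Proof. by move=> a b; rewrite -(quoreprK x) !quopiZ scalerDl raddfD. Qed.

HB.instance Definition _ := GRing.Zmodule_isLmodule.Build k quoalg
  quoscaleA quoscale1 quoscaleDr quoscaleDl.

Lemma quopi_scalable : scalable quopi.
Proof. by move=> c x; rewrite -quopiZ. Qed.

HB.instance Definition _ := GRing.isScalable.Build k A quoalg *:%R quopi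
  quopi_scalable.

Definition quoop (x y : quoalg) : quoalg := quopi (op (quorepr x) (quorepr y)).

Lemma quopi_op x y : (forall z, zmod_morphism (op z)) ->
  (forall z, zmod_morphism (op^~ z)) ->
  quoop (quopi x) (quopi y) = quopi (op x y).
Proof.
move=> opr opl; apply/eq_quopi.
set x' := quorepr _; set y' := quorepr _.
have -> : op x' y' - op x y = op (x' - x) y' + op x (y' - y).
  by rewrite opr opl addrA subrK.
by apply: gen_idealD; [apply: gen_idealMr | apply: gen_idealMl];
  apply/eq_quopi/quoreprK.
Qed.

End IdealQuotient.

Section MagmaAlgebra.
Variables (k : fieldType) (K : choiceType) (m : K -> K -> K).

Definition malg_op (g h : {malg k[K]}) : {malg k[K]} :=
  \sum_(x <- msupp g) \sum_(y <- msupp h) << g@_x * h@_y *g m x y >>.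

Lemma malg_opw (d1 d2 : {fset K}) g h :
  (msupp g `<=` d1)%fset -> (msupp h `<=` d2)%fset ->
  malg_op g h = \sum_(x <- d1) \sum_(y <- d2) << g@_x * h@_y *g m x y >>.
Proof.
move=> le1 le2; rewrite /malg_op (big_fset_incl _ le1) /=.
  apply: eq_bigr => x _; apply: big_fset_incl => // y _ /mcoeff_outdom ->.
  by rewrite mulr0 monalgU0.
move=> x _ /mcoeff_outdom gx.
by rewrite big1 // => y _; rewrite gx mul0r monalgU0.
Qed.

Lemma malg_opUU c1 c2 x y :
  malg_op << c1 *g x >> << c2 *g y >> = << c1 * c2 *g m x y >>.
Proof.
by rewrite (malg_opw msuppU_le msuppU_le) !big_seq_fset1 !mcoeffUU.
Qed.

Lemma malg_op_linearr g : linear (malg_op g).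
Proof.
move=> c h1 h2.
set d := (msupp (c *: h1 + h2) `|` (msupp h1 `|` msupp h2))%fset.
have s0 : (msupp (c *: h1 + h2) `<=` d)%fset by apply: fsubsetUl.
have s1 : (msupp h1 `<=` d)%fset
  by apply: (fsubset_trans (fsubsetUl _ (msupp h2))); apply: fsubsetUr.
have s2 : (msupp h2 `<=` d)%fset
  by apply: (fsubset_trans (fsubsetUr (msupp h1) _)); apply: fsubsetUr.
rewrite (malg_opw (fsubset_refl _) s0) (malg_opw (fsubset_refl _) s1).
rewrite (malg_opw (fsubset_refl _) s2) scaler_sumr -big_split /=.
apply: eq_bigr => x _; rewrite scaler_sumr -big_split /=.
apply: eq_bigr => y _; apply/malgP => z.
by rewrite !mcoeffsE mulrnAr -mulrnDl mulrDr mulrCA.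
Qed.

Lemma malg_op_linearl h : linear (malg_op^~ h).
Proof.
move=> c g1 g2 /=.
set d := (msupp (c *: g1 + g2) `|` (msupp g1 `|` msupp g2))%fset.
have s0 : (msupp (c *: g1 + g2) `<=` d)%fset by apply: fsubsetUl.
have s1 : (msupp g1 `<=` d)%fset
  by apply: (fsubset_trans (fsubsetUl _ (msupp g2))); apply: fsubsetUr.
have s2 : (msupp g2 `<=` d)%fset
  by apply: (fsubset_trans (fsubsetUr (msupp g1) _)); apply: fsubsetUr.
rewrite (malg_opw s0 (fsubset_refl _)) (malg_opw s1 (fsubset_refl _)).
rewrite (malg_opw s2 (fsubset_refl _)) scaler_sumr -big_split /=.
apply: eq_bigr => x _; rewrite scaler_sumr -big_split /=.
apply: eq_bigr => y _; apply/malgP => z.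
by rewrite !mcoeffsE mulrnAr -mulrnDl mulrDl mulrA.
Qed.

End MagmaAlgebra.

(** [gen_a i] and [gen_b i] stand for a_{i+1} and b_{i+1}. *)
Inductive generator := gen_d | gen_a of nat | gen_b of nat.

Inductive lie_word := LGen of generator | LBr of lie_word & lie_word.

HB.instance Definition _ := gen_eqMixin lie_word.
HB.instance Definition _ := gen_choiceMixin lie_word.

Definition gen_deg (g : generator) : int :=
  match g with gen_d => -1 | gen_a _ => -1 | gen_b _ => 0 end.

Definition gen_weight (g : generator) : nat :=
  match g with gen_d => 0 | gen_a i => i.+1 | gen_b i => i.+1 end.

Fixpoint word_deg (w : lie_word) : int :=
  match w with
  | LGen g => gen_deg g
  | LBr u v => word_deg u + word_deg v
  end.

Fixpoint word_weight (w : lie_word) : nat :=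
  match w with
  | LGen g => gen_weight g
  | LBr u v => (word_weight u + word_weight v)%N
  end.

Section GradedLie.
Variable k : fieldType.

Definition preL := {malg k[lie_word]}.
Definition preL_br : preL -> preL -> preL := malg_op LBr.

Definition preL_deg (p : int) (x : preL) : Prop :=
  {in msupp x, forall w, word_deg w = p}.
Definition preL_weight (n : nat) (x : preL) : Prop :=
  {in msupp x, forall w, word_weight w = n}.

Definition pre_d : preL := << LGen gen_d >>.
(** Index 0 is given the value 0, so that [pre_a n] is a_n for n >= 1. *)
Definition pre_a (n : nat) : preL :=
  if n is i.+1 then << LGen (gen_a i) >> else 0.
Definition pre_b (n : nat) : preL :=
  if n is i.+1 then << LGen (gen_b i) >> else 0.

(** Graded antisymmetry and graded Jacobi identity with Koszul signs, and the
    defining relations.  As k has characteristic zero, the identities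
    [x,x] = 0 (x even) and [x,[x,x]] = 0 (x odd) are consequences. *)
Inductive L_relator : preL -> Prop :=
| L_antisym p q x y : preL_deg p x -> preL_deg q y ->
    L_relator (preL_br x y + (-1) ^ (p * q) *: preL_br y x)
| L_jacobi p q r x y z : preL_deg p x -> preL_deg q y -> preL_deg r z ->
    L_relator (preL_br x (preL_br y z)
               - (preL_br (preL_br x y) z
                  + (-1) ^ (p * q) *: preL_br y (preL_br x z)))
| L_twisted n : (0 < n)%N ->
    L_relator (preL_br (pre_b n) pre_d
               - (pre_a n - \sum_(1 <= i < n)
                    (i%:R / n%:R) *: preL_br (pre_b i) (pre_a (n - i)))).

Definition L := quoalg preL_br L_relator.
HB.instance Definition _ := GRing.Lmodule.on L.

Definition lbr : L -> L -> L := @quoop _ _ preL_br L_relator.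
Definition toL : preL -> L := @quopi _ _ preL_br L_relator.
HB.instance Definition _ := GRing.Linear.on toL.

Definition L_deg (p : int) (x : L) : Prop :=
  exists2 y, preL_deg p y & x = toL y.
Definition L_weight (n : nat) (x : L) : Prop :=
  exists2 y, preL_weight n y & x = toL y.

Definition L_d : L := toL pre_d.
Definition L_a (n : nat) : L := toL (pre_a n).
Definition L_b (n : nat) : L := toL (pre_b n).

Lemma toL_br x y : lbr (toL x) (toL y) = toL (preL_br x y).
Proof.
apply: quopi_op => z; apply: zmod_morphism_linear.
  exact: malg_op_linearr.
exact: malg_op_linearl.
Qed.

Lemma toL_surj x : exists y, x = toL y.
Proof. by exists (quorepr x); rewrite [RHS]quoreprK. Qed.

Lemma toL_eq0 x : L_relator x -> toL x = 0.
Proof.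
move=> Rx; rewrite -(raddf0 toL); apply/eq_quopi.
by rewrite subr0; apply: gen_ideal_rel.
Qed.

Lemma lbr_linearr x : linear (lbr x).
Proof.
have [x' ->] := toL_surj x; move=> c y z.
have [y' ->] := toL_surj y; have [z' ->] := toL_surj z.
by rewrite -linearP !toL_br /preL_br malg_op_linearr linearP.
Qed.

Lemma lbr_linearl y : linear (lbr^~ y).
Proof.
have [y' ->] := toL_surj y; move=> c x z /=.
have [x' ->] := toL_surj x; have [z' ->] := toL_surj z.
by rewrite -linearP !toL_br /preL_br malg_op_linearl linearP.
Qed.

Lemma lbr_antisym p q x y : L_deg p x -> L_deg q y ->
  lbr x y = - ((-1) ^ (p * q) *: lbr y x).
Proof.
move=> [x' px ->] [y' qy ->]; apply/eqP; rewrite -addr_eq0; apply/eqP.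
rewrite !toL_br -linearZ -raddfD; apply: toL_eq0; exact: L_antisym px qy.
Qed.

Lemma lbr_jacobi p q r x y z : L_deg p x -> L_deg q y -> L_deg r z ->
  lbr x (lbr y z) = lbr (lbr x y) z + (-1) ^ (p * q) *: lbr y (lbr x z).
Proof.
move=> [x' px ->] [y' qy ->] [z' rz ->]; apply/eqP.
rewrite -subr_eq0; apply/eqP.
rewrite !toL_br -linearZ -raddfD -raddfB; apply: toL_eq0; exact: L_jacobi px qy rz.
Qed.

Lemma lbr_b_d n : (0 < n)%N ->
  lbr (L_b n) L_d
  = L_a n - \sum_(1 <= i < n) (i%:R / n%:R) *: lbr (L_b i) (L_a (n - i)).
Proof.
move=> n0; apply/eqP; rewrite -subr_eq0; apply/eqP.
under eq_bigr do rewrite toL_br -linearZ.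
by rewrite -raddf_sum toL_br -!raddfB; apply: toL_eq0; apply: L_twisted.
Qed.

Lemma preL_weight_br m n x y : preL_weight m x -> preL_weight n y ->
  preL_weight (m + n) (preL_br x y).
Proof.
move=> hx hy w; rewrite -mcoeff_neq0 => nz.
have [u ux [v vy ->]] :
    exists2 u, u \in msupp x & exists2 v, v \in msupp y & w = LBr u v.
  apply: contrapT => H; case/eqP: nz.
  rewrite /preL_br /malg_op raddf_sum big_seq big1 // => u ux.
  rewrite raddf_sum big_seq big1 // => v vy; rewrite /= mcoeffU.
  by case: eqP => // E; case: H; exists u => //; exists v.
by rewrite /= (hx _ ux) (hy _ vy).
Qed.

Lemma L_weight_br m n x y : L_weight m x -> L_weight n y ->
  L_weight (m + n) (lbr x y).
Proof.
move=> [x' hx ->] [y' hy ->]; exists (preL_br x' y'); last exact: toL_br.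
exact: preL_weight_br.
Qed.

Lemma L_weightZ n c x : L_weight n x -> L_weight n (c *: x).
Proof.
move=> [y hy ->]; exists (c *: y); last by rewrite linearZ.
by move=> w /(fsubsetP (msuppZ_le _ _)) /hy.
Qed.

Lemma L_weight0 n : L_weight n 0.
Proof. by exists 0; [move=> w; rewrite msupp0 | rewrite raddf0]. Qed.

Lemma L_b_weight n : L_weight n (L_b n).
Proof.
case: n => [|n]; first by rewrite /L_b raddf0; apply: L_weight0.
exists (pre_b n.+1) => // w /(fsubsetP msuppU_le).
by rewrite in_fset1 => /eqP ->.
Qed.

Lemma L_b_deg n : L_deg 0 (L_b n).
Proof.
exists (pre_b n) => // w; case: n => [|n]; first by rewrite msupp0.
by move/(fsubsetP msuppU_le); rewrite in_fset1 => /eqP ->.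
Qed.

End GradedLie.

(** The universal enveloping algebra of the graded Lie algebra [V] is a
    quotient of the tensor algebra of [V]; the latter is obtained from the free
    associative algebra on the underlying set of [V] by the relators
    [env_linear]. *)

Section Envelope.
Variables (k : fieldType) (V : lmodType k) (br : V -> V -> V).
Variable hdeg : int -> V -> Prop.

Local Notation preU := {malg k[{fmonom V}]}.
Definition letter (x : V) : preU := << fmu x >>.

Inductive env_relator : preU -> Prop :=
| env_linear c x y :
    env_relator (letter (c *: x + y) - (c *: letter x + letter y))
| env_bracket p q x y : hdeg p x -> hdeg q y ->
    env_relator (letter (br x y)
      - (letter x * letter y - (-1) ^ (p * q) *: (letter y * letter x))).

Definition env := quoalg (@GRing.mul preU) env_relator.
HB.instance Definition _ := GRing.Lmodule.on env.

Definition toU : preU -> env := @quopi _ _ (@GRing.mul preU) env_relator.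
HB.instance Definition _ := GRing.Linear.on toU.

Definition env_mul : env -> env -> env :=
  @quoop _ _ (@GRing.mul preU) env_relator.
Definition env_one : env := toU 1.

Lemma toU_surj x : exists y, x = toU y.
Proof. by exists (quorepr x); rewrite [RHS]quoreprK. Qed.

Lemma env_mulE x y : env_mul (toU x) (toU y) = toU (x * y).
Proof. by apply: quopi_op => z u v; rewrite ?mulrBl ?mulrBr. Qed.

Lemma env_mulA : associative env_mul.
Proof.
move=> x y z; have [x' ->] := toU_surj x; have [y' ->] := toU_surj y.
by have [z' ->] := toU_surj z; rewrite !env_mulE mulrA.
Qed.

Lemma env_mul1 : left_id env_one env_mul.
Proof. by move=> x; have [x' ->] := toU_surj x; rewrite env_mulE mul1r. Qed.

Lemma env_mulr1 : right_id env_one env_mul.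
Proof. by move=> x; have [x' ->] := toU_surj x; rewrite env_mulE mulr1. Qed.

Lemma env_mulDl : left_distributive env_mul +%R.
Proof.
move=> x y z; have [x' ->] := toU_surj x; have [y' ->] := toU_surj y.
by have [z' ->] := toU_surj z; rewrite -raddfD !env_mulE mulrDl raddfD.
Qed.

Lemma env_mulDr : right_distributive env_mul +%R.
Proof.
move=> x y z; have [x' ->] := toU_surj x; have [y' ->] := toU_surj y.
by have [z' ->] := toU_surj z; rewrite -raddfD !env_mulE mulrDr raddfD.
Qed.

Lemma letter_coeff1 x : (letter x)@_mone = 0.
Proof. by rewrite /letter mcoeffU -fdeg_eq0 fdegU. Qed.

(** Nontriviality: the coefficient of the empty word vanishes on the ideal. *)
Lemma env_one_neq0 : env_one != 0.
Proof.
apply/eqP; rewrite -(raddf0 toU) => /eq_quopi; rewrite subr0.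
suff H x : gen_ideal (@GRing.mul preU) env_relator x -> x@_mone = 0.
  by move/H/eqP; rewrite mcoeffU eqxx oner_eq0.
elim=> {x} [x [c x' y|p q x' y _ _]||x y _ Hx _ Hy|c x _ Hx|x y _ Hy|x y _ Hx].
- by rewrite mcoeffB mcoeffD mcoeffZ !letter_coeff1 mulr0 !addr0 subrr.
- by rewrite !mcoeffB mcoeffZ !rmorphM /= !letter_coeff1 !mulr0 !subr0.
- exact: mcoeff0.
- by rewrite mcoeffD Hx Hy addr0.
- by rewrite mcoeffZ Hx mulr0.
- by rewrite rmorphM /= Hy mulr0.
- by rewrite rmorphM /= Hx mul0r.
Qed.

HB.instance Definition _ := GRing.Zmodule_isNzRing.Build env
  env_mulA env_mul1 env_mulr1 env_mulDl env_mulDr env_one_neq0.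

Lemma toU_mul x y : toU x * toU y = toU (x * y).
Proof. exact: env_mulE. Qed.

Lemma toU_scale c x : c *: toU x = toU (c *: x).
Proof. by rewrite -linearZ. Qed.

Lemma env_scalerAl (c : k) (x y : env) : c *: (x * y) = c *: x * y.
Proof.
have [x' ->] := toU_surj x; have [y' ->] := toU_surj y.
by rewrite (toU_scale c x') !toU_mul toU_scale -scalerAl.
Qed.

HB.instance Definition _ := GRing.Lmodule_isLalgebra.Build k env env_scalerAl.

Lemma preU_scalerAr c (x y : preU) : c *: (x * y) = x * (c *: y).
Proof.
have := malg_op_linearr (@mmul {fmonom V}) x c y 0.
by rewrite -[malg_op _ x 0]/(x * 0) mulr0 !addr0.
Qed.

Lemma env_scalerAr (c : k) (x y : env) : c *: (x * y) = x * (c *: y).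
Proof.
have [x' ->] := toU_surj x; have [y' ->] := toU_surj y.
rewrite (toU_scale c y') !toU_mul toU_scale; congr (toU _).
exact: preU_scalerAr.
Qed.

HB.instance Definition _ := GRing.Lalgebra_isAlgebra.Build k env env_scalerAr.

Definition iota_env (x : V) : env := toU (letter x).

Lemma iota_env_linear : linear iota_env.
Proof.
move=> c x y; apply/eqP; rewrite -subr_eq0; apply/eqP.
rewrite /iota_env toU_scale -raddfD -raddfB -(raddf0 toU); apply/eq_quopi.
by rewrite subr0; apply: gen_ideal_rel; apply: env_linear.
Qed.

Lemma iota_env_br p q x y : hdeg p x -> hdeg q y ->
  iota_env (br x y)
  = iota_env x * iota_env y - (-1) ^ (p * q) *: (iota_env y * iota_env x).
Proof.
move=> px qy; apply/eqP; rewrite -subr_eq0; apply/eqP.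
rewrite /iota_env !toU_mul toU_scale -!raddfB -(raddf0 toU); apply/eq_quopi.
by rewrite subr0; apply: gen_ideal_rel; apply: env_bracket.
Qed.

End Envelope.

(** The weights on the algebra [A] are generated by [G], where [G n x] means
    that [x] is a generator of weight [n]; [wt_comp n] is the weight
    component of weight [n], and [completion] the product of these components
    over all weights. *)

Section Completion.
Variables (k : fieldType) (A : algType k) (G : nat -> A -> Prop).

Inductive wt_comp : nat -> A -> Prop :=
| wt_gen n x : G n x -> wt_comp n x
| wt_one : wt_comp 0 1
| wt_zero n : wt_comp n 0
| wt_add n x y : wt_comp n x -> wt_comp n y -> wt_comp n (x + y)
| wt_scale n c x : wt_comp n x -> wt_comp n (c *: x)
| wt_mul m n x y : wt_comp m x -> wt_comp n y -> wt_comp (m + n) (x * y).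

Lemma wt_opp n x : wt_comp n x -> wt_comp n (- x).
Proof. by rewrite -scaleN1r; apply: wt_scale. Qed.

Lemma wt_sum n (I : Type) (r : seq I) (P : pred I) (F : I -> A) :
  (forall i, P i -> wt_comp n (F i)) -> wt_comp n (\sum_(i <- r | P i) F i).
Proof. by move=> H; elim/big_ind: _ => //; [apply: wt_zero | apply: wt_add]. Qed.

Record completion := Completion {
  comp :> nat -> A;
  compP : forall n, wt_comp n (comp n)
}.

Lemma completionP (u v : completion) : (forall n, u n = v n) -> u = v.
Proof.
case: u v => [u Hu] [v Hv] /= /funext uv; case: _ / uv in Hv *.
by congr Completion; apply: Prop_irrelevance.
Qed.

HB.instance Definition _ := gen_eqMixin completion.
HB.instance Definition _ := gen_choiceMixin completion.

Definition hat_zero := Completion wt_zero.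
Definition hat_opp (u : completion) :=
  Completion (fun n => wt_opp (compP u n)).
Definition hat_add (u v : completion) :=
  Completion (fun n => wt_add (compP u n) (compP v n)).
Definition hat_scale (c : k) (u : completion) :=
  Completion (fun n => wt_scale c (compP u n)).

Lemma hat_addA : associative hat_add.
Proof. by move=> u v w; apply: completionP => n /=; rewrite addrA. Qed.
Lemma hat_addC : commutative hat_add.
Proof. by move=> u v; apply: completionP => n /=; rewrite addrC. Qed.
Lemma hat_add0 : left_id hat_zero hat_add.
Proof. by move=> u; apply: completionP => n /=; rewrite add0r. Qed.
Lemma hat_addN : left_inverse hat_zero hat_opp hat_add.
Proof. by move=> u; apply: completionP => n /=; rewrite addNr. Qed.

HB.instance Definition _ := GRing.isZmodule.Build completion
  hat_addA hat_addC hat_add0 hat_addN.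

Lemma comp0 n : (0 : completion) n = 0. Proof. by []. Qed.
Lemma compD (u v : completion) n : (u + v) n = u n + v n. Proof. by []. Qed.
Lemma compN (u : completion) n : (- u) n = - u n. Proof. by []. Qed.

Lemma hat_one_subproof n : wt_comp n (if n is 0 then 1 else 0).
Proof. by case: n => [|n]; [apply: wt_one | apply: wt_zero]. Qed.
Definition hat_one := Completion hat_one_subproof.

Lemma hat_mul_subproof (u v : completion) n :
  wt_comp n (\sum_(i < n.+1) u i * v (n - i)%N).
Proof.
apply: wt_sum => i _; rewrite -[n in wt_comp n](subnKC (leq_ord i)).
by apply: wt_mul; apply: compP.
Qed.
Definition hat_mul (u v : completion) := Completion (hat_mul_subproof u v).

Lemma hat_mul_rev (u v : completion) n :
  hat_mul u v n = \sum_(i < n.+1) u (n - i)%N * v i.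
Proof.
rewrite /= (reindex_inj rev_ord_inj) /=; apply: eq_bigr => i _.
by rewrite subSS subKn ?leq_ord.
Qed.

Lemma hat_mulA : associative hat_mul.
Proof.
move=> u v w; apply: completionP => n.
rewrite [RHS]hat_mul_rev [LHS]/=.
pose coef3 j l := u j * (v (n - j - l)%N * w l).
transitivity (\sum_(j < n.+1) \sum_(l < n.+1 | (l <= n - j)%N) coef3 j l).
  apply: eq_bigr => j _; rewrite -[\sum_(_ < _) _]/(hat_mul v w (n - j)%N).
  rewrite hat_mul_rev big_distrr /=.
  by rewrite (big_ord_narrow_leq (leq_subr _ _)).
rewrite (exchange_big_dep predT) //=; apply: eq_bigr => l _.
transitivity (\sum_(j < n.+1 | (j <= n - l)%N) coef3 j l).
  apply: eq_bigl => j; rewrite -ltnS -(ltnS j) -!subSn ?leq_ord //.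
  by rewrite -subn_gt0 -(subn_gt0 j) -!subnDA addnC.
rewrite (big_ord_narrow_leq (leq_subr _ _)) big_distrl /=.
by apply: eq_bigr => j _; rewrite /coef3 -!subnDA addnC mulrA.
Qed.

Lemma hat_mul1 : left_id hat_one hat_mul.
Proof.
move=> u; apply: completionP => n; rewrite /= big_ord_recl /= mul1r subn0.
by rewrite big1 ?addr0 // => i _; rewrite mul0r.
Qed.

Lemma hat_mulr1 : right_id hat_one hat_mul.
Proof.
move=> u; apply: completionP => n; rewrite hat_mul_rev big_ord_recl /= mulr1.
by rewrite subn0 big1 ?addr0 // => i _; rewrite mulr0.
Qed.

Lemma hat_mulDl : left_distributive hat_mul +%R.
Proof.
move=> u v w; apply: completionP => n; rewrite compD /= -big_split /=.
by apply: eq_bigr => i _; rewrite mulrDl.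
Qed.

Lemma hat_mulDr : right_distributive hat_mul +%R.
Proof.
move=> u v w; apply: completionP => n; rewrite compD /= -big_split /=.
by apply: eq_bigr => i _; rewrite mulrDr.
Qed.

Lemma hat_one_neq0 : hat_one != 0.
Proof.
by apply/eqP => /(congr1 (fun u : completion => u 0%N)) /eqP; rewrite oner_eq0.
Qed.

HB.instance Definition _ := GRing.Zmodule_isNzRing.Build completion
  hat_mulA hat_mul1 hat_mulr1 hat_mulDl hat_mulDr hat_one_neq0.

Lemma compM (u v : completion) n :
  (u * v) n = \sum_(i < n.+1) u i * v (n - i)%N.
Proof. by []. Qed.
Lemma comp1 n : (1 : completion) n = (n == 0%N)%:R.
Proof. by case: n. Qed.

Lemma hat_scaleA c e u : hat_scale c (hat_scale e u) = hat_scale (c * e) u.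
Proof. by apply: completionP => n /=; rewrite scalerA. Qed.
Lemma hat_scale1 : left_id 1 hat_scale.
Proof. by move=> u; apply: completionP => n /=; rewrite scale1r. Qed.
Lemma hat_scaleDr : right_distributive hat_scale +%R.
Proof. by move=> c u v; apply: completionP => n /=; rewrite scalerDr. Qed.
Lemma hat_scaleDl u : {morph hat_scale^~ u : c e / c + e}.
Proof. by move=> c e; apply: completionP => n /=; rewrite scalerDl. Qed.

HB.instance Definition _ := GRing.Zmodule_isLmodule.Build k completion
  hat_scaleA hat_scale1 hat_scaleDr hat_scaleDl.

Lemma compZ c (u : completion) n : (c *: u) n = c *: u n.
Proof. by []. Qed.

Lemma hat_scalerAl c (u v : completion) : c *: (u * v) = c *: u * v.
Proof.
apply: completionP => n; rewrite compZ !compM scaler_sumr.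
by apply: eq_bigr => i _; rewrite scalerAl.
Qed.

HB.instance Definition _ := GRing.Lmodule_isLalgebra.Build k completion
  hat_scalerAl.

Lemma hat_scalerAr c (u v : completion) : c *: (u * v) = u * (c *: v).
Proof.
apply: completionP => n; rewrite compZ !compM scaler_sumr.
by apply: eq_bigr => i _; rewrite scalerAr.
Qed.

HB.instance Definition _ := GRing.Lalgebra_isAlgebra.Build k completion
  hat_scalerAr.

Lemma hat_homog_subproof n x (wx : wt_comp n x) m :
  wt_comp m (if m == n then x else 0).
Proof. by case: eqP => [->|_] //; apply: wt_zero. Qed.
Definition hat_homog n x (wx : wt_comp n x) :=
  Completion (hat_homog_subproof wx).

(** Infinite sums in the product of the (discrete) weight components: a family
    is summable if each component is nonzero for finitely many indices only,
    and its sum is then taken componentwise. *)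
Definition hat_summable (I : choiceType) (D : set I) (t : I -> completion) :=
  forall n, finite_set (D `&` [set i | t i n != 0]).

Lemma hat_sum_subproof (I : choiceType) (D : set I) (t : I -> completion) n :
  wt_comp n (\sum_(i \in D) t i n).
Proof. by apply: wt_sum => i _; apply: compP. Qed.
Definition hat_sum (I : choiceType) (D : set I) (t : I -> completion) :=
  Completion (hat_sum_subproof D t).

(** On homogeneous elements this is w(u) / (w(u) + w(v)) u v, extended
    bilinearly and continuously.  It is meant for arguments of positive weight,
    that is, with zero component in weight 0. *)
Lemma hat_prec_subproof (u v : completion) n :
  wt_comp n (\sum_(i < n.+1) (i%:R / (i + (n - i))%:R) *: (u i * v (n - i)%N)).
Proof.
apply: wt_sum => i _; rewrite -[n in wt_comp n](subnKC (leq_ord i)).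
by apply: wt_scale; apply: wt_mul; apply: compP.
Qed.
Definition hat_prec (u v : completion) := Completion (hat_prec_subproof u v).

(** [prec_pow u j] is the j-th power for [hat_prec], for j >= 1. *)
Definition prec_pow (u : completion) (j : nat) := iter j.-1 (hat_prec u) u.

(** [hat_log1p u] is log (1 + u), for u with zero component in weight 0. *)
Definition hat_log1p (u : completion) :=
  hat_sum [set n | (0 < n)%N] (fun n => ((-1) ^+ n.-1 / n%:R) *: u ^+ n).

Lemma finite_set_le (D : set nat) n : (forall i, D i -> (i <= n)%N) ->
  finite_set D.
Proof.
move=> H; apply: (@sub_finite_set _ _ `I_n.+1) => [i /H|]; last exact: finite_II.
by rewrite /= ltnS.
Qed.

Lemma prec_pow_lt (u : completion) j n :
  u 0%N = 0 -> (n < j)%N -> prec_pow u j n = 0.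
Proof.
move=> u0; case: j => // j; elim: j n => [|j IHj] n; first by case: n.
rewrite ltnS => le_nj; rewrite /prec_pow /= big1 // => -[[|i] lt_in] _ /=.
  by rewrite mul0r scale0r.
rewrite -[iter _ _ _]/(prec_pow u j.+1) IHj ?mulr0 ?scaler0 //.
rewrite ltnS in lt_in.
by case: n le_nj lt_in => // n le_nj _; rewrite subSS (leq_ltn_trans (leq_subr _ _)).
Qed.

Lemma exp_lt (u : completion) j n : u 0%N = 0 -> (n < j)%N -> (u ^+ j) n = 0.
Proof.
move=> u0; elim: j n => // j IHj n; rewrite ltnS => le_nj.
rewrite exprS compM big1 // => -[[|i] lt_in] _ /=; first by rewrite u0 mul0r.
rewrite IHj ?mulr0 //; rewrite ltnS in lt_in.
by apply: leq_trans le_nj; rewrite ltn_subrL (leq_ltn_trans _ lt_in).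
Qed.

Lemma prec_pow_summable (u : completion) : u 0%N = 0 ->
  hat_summable [set j | (0 < j)%N] (prec_pow u).
Proof.
move=> u0 n; apply: (@finite_set_le _ n) => j [_ /= nz].
by rewrite leqNgt; apply: contra nz => /(prec_pow_lt u0) ->.
Qed.

Lemma hat_log1p_summable (u : completion) : u 0%N = 0 ->
  hat_summable [set n | (0 < n)%N]
    (fun n => ((-1) ^+ n.-1 / n%:R) *: u ^+ n).
Proof.
move=> u0 n; apply: (@finite_set_le _ n) => j [_ /= nz].
by rewrite leqNgt; apply: contra nz => /(exp_lt u0) ->; rewrite scaler0.
Qed.

End Completion.

Section Xi.
Variable k : fieldType.

Definition U := env (@lbr k) (@L_deg k).
HB.instance Definition _ := GRing.Algebra.on U.

Definition iota_U : L k -> U := @iota_env k (L k) (@lbr k) (@L_deg k).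

Definition U_gen (n : nat) (x : U) : Prop :=
  exists2 y, L_weight n y & x = iota_U y.

Definition hatU := completion U_gen.
HB.instance Definition _ := GRing.Algebra.on hatU.

Lemma iota_U_weight n (x : L k) : L_weight n x -> wt_comp U_gen n (iota_U x).
Proof. by move=> wx; apply: wt_gen; exists x. Qed.
Definition hat_iota n (x : L k) (wx : L_weight n x) : hatU :=
  hat_homog (iota_U_weight wx).

Definition beta : hatU :=
  hat_sum [set i | (0 < i)%N] (fun i => hat_iota (L_b_weight k i)).

Definition L_f (i : nat) : L k := i%:R *: L_b k i.

(** [ad_f [:: i_1; ...; i_n]] is ad_{f_{i_n}} ... ad_{f_{i_2}} (f_{i_1}). *)
Definition ad_f (s : seq nat) : L k :=
  if s is i :: s' then foldl (fun x j => lbr (L_f j) x) (L_f i) s' else 0.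

Lemma ad_f_weight s : L_weight (sumn s) (ad_f s).
Proof.
case: s => [|i s]; first exact: L_weight0.
have wf j : L_weight j (L_f j) by apply/L_weightZ/L_b_weight.
rewrite /=; move: (L_f i) (wf i); elim: s i => [|j s IHs] m x wx /=.
  by rewrite addn0.
by rewrite addnA (addnC m); apply: IHs; apply: L_weight_br.
Qed.

Definition descents (n : nat) (tau : 'S_n.+1) : nat :=
  #|[pred l : 'I_n | tau (lift ord0 l) < tau (widen_ord (leqnSn n) l)]%N|.

(** The coefficient of ad_{f_{i_n}} ... ad_{f_{i_2}} (f_{i_1}) in [xi], for
    n = m+1 and t = (i_1, ..., i_n). *)
Definition xi_coef (m : nat) (t : m.+1.-tuple nat) : k :=
  m.+1%:R^-1 * \sum_(rho : 'S_m.+1 | rho ord0 == ord0)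
    ((-1) ^+ descents rho^-1%g / 'C(m, descents rho^-1%g)%:R
     * \prod_(j < m.+1) (\sum_(l < m.+1 | (l <= j)%N) tnth t (rho l))%:R^-1).

Definition xi_term (m : nat) (t : m.+1.-tuple nat) : hatU :=
  xi_coef t *: hat_iota (ad_f_weight t).

Definition pos_tuples (m : nat) : set (m.+1.-tuple nat) :=
  [set t | forall j, (0 < tnth t j)%N].
Arguments pos_tuples : clear implicits.

Definition xi : hatU :=
  hat_sum [set: nat] (fun m : nat => hat_sum (pos_tuples m) (@xi_term m)).

Lemma beta_summable :
  hat_summable [set i | (0 < i)%N] (fun i => hat_iota (L_b_weight k i)).
Proof.
move=> n; apply: (@finite_set_le _ n) => i [_ /=].
by case: (n =P i) => [->|] //; rewrite eqxx.
Qed.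

Lemma beta0 : beta 0%N = 0.
Proof.
rewrite /beta /hat_sum /=; apply: fsbig1 => i /= i0.
by rewrite eq_sym eqn0Ngt i0.
Qed.

Lemma prec_pow_beta_summable : hat_summable [set j | (0 < j)%N] (prec_pow beta).
Proof. exact/prec_pow_summable/beta0. Qed.

Lemma log_beta_summable :
  let F := hat_sum [set j | (0 < j)%N] (prec_pow beta) in
  hat_summable [set n | (0 < n)%N] (fun n => ((-1) ^+ n.-1 / n%:R) *: F ^+ n).
Proof.
move=> F; apply: hat_log1p_summable; rewrite /F /hat_sum /=.
by apply: fsbig1 => j /= j0; apply: prec_pow_lt => //; apply: beta0.
Qed.

Lemma xi_term_eq0 m (t : m.+1.-tuple nat) n : n != sumn t -> xi_term t n = 0.
Proof. by move=> /negPf E; rewrite /xi_term compZ /= E scaler0. Qed.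

Lemma xi_inner_summable m : hat_summable (pos_tuples m) (@xi_term m).
Proof.
move=> n.
have fin : finite_set ((fun s : m.+1.-tuple 'I_n.+1 => map_tuple val s) @` setT).
  exact/finite_image/finite_finset.
apply: sub_finite_set fin => t [_ /= nz].
have {nz} sumt : n = sumn t.
  apply/eqP; apply: contraT => /xi_term_eq0 E; case/eqP: nz; exact: E.
have le_t j : (tnth t j < n.+1)%N.
  rewrite ltnS sumt sumnE big_tuple (bigD1 j) //=; exact: leq_addr.
exists [tuple Ordinal (le_t j) | j < m.+1] => //=.
by apply: eq_from_tnth => j; rewrite tnth_map tnth_mktuple.
Qed.

Lemma xi_summable :
  hat_summable [set: nat] (fun m : nat => hat_sum (pos_tuples m) (@xi_term m)).
Proof.
move=> n; apply: (@finite_set_le _ n) => m [_ /= nz].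
rewrite leqNgt; apply: contra nz => lt_nm; apply/eqP; apply: fsbig1 => t /= post.
apply: xi_term_eq0; rewrite neq_ltn; apply/orP; left.
apply: (leq_trans lt_nm); rewrite sumnE big_tuple; apply: ltnW.
rewrite -[X in (X <= _)%N]card_ord -sum1_card.
by apply: leq_sum => j _; apply: post.
Qed.

End Xi.

(* Main.v *)
Require Import Defs.
From HB Require Import structures.
From mathcomp Require Import all_boot all_order all_fingroup all_algebra.
From mathcomp Require Import boolp classical_sets cardinality fsbigop.
From mathcomp Require Import finmap monalg.

Set Implicit Arguments.
Unset Strict Implicit.
Unset Printing Implicit Defensive.

Import GRing.Theory.

Local Open Scope ring_scope.
Local Open Scope classical_set_scope.

(** Let F be 1 plus the sum of the powers of beta.  The definition of the
    product gives [n F_n = \sum_i f_i F_(n-i)], so F is the value at s = 0 of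
    the solution y of [y' = - y a(s)], y(1) = 1, with
    [a(s) = \sum_i s^(i-1) f_i]: the product of y(s) with [\sum_n F_n s^n] is
    constant.  Hence log F is the integral over [0, 1] of minus the derivative
    of log y.  With u = y - 1 that derivative is
    [- \sum_(i,j) (-1)^(i+j) / (i+j+1) u^i (y a) u^j]; by the Beta integral it
    is also [- \sum_j (-1)^j / (j+1) Ad_y (Ad_y - 1)^j a].  As Ad_y solves a
    differential equation too, it is the sum over all words w of the iterated
    integral of w times the iterated commutator along w, so the coefficient of
    an iterated commutator in log F is a sum, over all ways of cutting its word
    into j + 1 pieces, of products of iterated integrals.  Such a product is
    the sum of the iterated integrals over all permutations that are increasing
    on each piece; finally, for a permutation tau of m + 1 letters with d
    descents, the sum of [(-1)^j / (j+1)] over all sets of j cuts that contain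
    the descents of tau is [(-1)^d / ((m+1) 'C(m, d))], again by a Beta
    integral. *)

(** * Integrals of polynomials over [x, 1] and [0, 1] *)

Section TailIntegral.
Variables (k : fieldType) (char0 : [pchar k] =i pred0).

Lemma succ_natf_neq0 n : (n.+1%:R : k) != 0.
Proof. by have /pcharf0P -> := char0. Qed.

Lemma scaled_mulrn_eq0 (V : lmodType k) (x : V) n : x *+ n.+1 = 0 -> x = 0.
Proof.
move=> /eqP; rewrite -scaler_nat scaler_eq0 (negPf (succ_natf_neq0 n)) /=.
by move/eqP.
Qed.

(** The uniqueness principle for the differential equations below. Torsion-freeness is a hypothesis
    so that it serves both [k] and a noncommutative coefficient algebra; the base point is 1 because
    iterated integrals vanish there. *)
Lemma deriv0_horner1_eq0 (A : nzRingType) (p : {poly A}) :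
  (forall (x : A) n, x *+ n.+1 = 0 -> x = 0) ->
  p^`() = 0 -> p.[1] = 0 -> p = 0.
Proof.
move=> A0 p'0 p1; have sp : (size p <= 1)%N.
  apply/leq_sizeP => -[|i] // _; apply: (A0 _ i).
  by rewrite -coef_deriv p'0 coef0.
by rewrite (size1_polyC sp) in p1 *; rewrite hornerC in p1; rewrite p1 polyC0.
Qed.

Lemma poly_deriv0_horner1_eq0 (p : {poly k}) : p^`() = 0 -> p.[1] = 0 -> p = 0.
Proof. by apply: deriv0_horner1_eq0; apply: (@scaled_mulrn_eq0 k^o). Qed.

(** [tailint q] is the integral of [q] from the variable to 1, and [unitint q]
    its integral from 0 to 1. *)
Definition tailint (q : {poly k}) : {poly k} :=
  \sum_(i < size q) (q`_i / i.+1%:R) *: (1 - 'X^(i.+1)).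
Definition unitint (q : {poly k}) : k := (tailint q).[0].

Lemma tailint_widen n (q : {poly k}) : (size q <= n)%N ->
  tailint q = \sum_(i < n) (q`_i / i.+1%:R) *: (1 - 'X^(i.+1)).
Proof.
move=> le_qn; pose F (i : nat) : {poly k} := (q`_i / i.+1%:R) *: (1 - 'X^(i.+1)).
rewrite /tailint (big_ord_widen n F le_qn) big_mkcond /=.
apply: eq_bigr => i _; case: ltnP => // le_qi.
by rewrite nth_default // mul0r scale0r.
Qed.

Lemma tailint_linear : linear tailint.
Proof.
move=> c p q; set n := maxn (size p) (size q).
rewrite (@tailint_widen n (c *: p + q)); last first.
  rewrite (leq_trans (size_polyD _ _)) // geq_max leq_maxr andbT.
  by rewrite (leq_trans (size_scale_leq _ _)) // leq_maxl.
rewrite (@tailint_widen n p) ?leq_maxl // (@tailint_widen n q) ?leq_maxr //.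
rewrite scaler_sumr -big_split /=; apply: eq_bigr => i _.
by rewrite coefD coefZ mulrDl scalerDl scalerA mulrA.
Qed.

HB.instance Definition _ :=
  GRing.isLinear.Build k {poly k} {poly k} *:%R tailint tailint_linear.

Lemma unitint_linear : linear_for *%R unitint.
Proof. by move=> c p q; rewrite /unitint linearP hornerD hornerZ. Qed.

HB.instance Definition _ :=
  GRing.isLinear.Build k {poly k} k *%R unitint unitint_linear.

Lemma deriv_tailint q : (tailint q)^`() = - q.
Proof.
rewrite -[in RHS](coefK q) poly_def /tailint raddf_sum -sumrN.
apply: eq_bigr => i _; rewrite /= derivZ derivB derivC derivXn sub0r /=.
by rewrite scalerN -scalerMnr scalerMnl -mulr_natr divfK ?succ_natf_neq0.
Qed.

Lemma tailint1 q : (tailint q).[1] = 0.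
Proof.
rewrite /tailint horner_sum big1 // => i _.
by rewrite hornerZ hornerD hornerN hornerXn hornerC expr1n subrr mulr0.
Qed.

Lemma tailint_uniq p q : p^`() = - q -> p.[1] = 0 -> p = tailint q.
Proof.
move=> dp p1; apply/eqP; rewrite -subr_eq0; apply/eqP.
apply: poly_deriv0_horner1_eq0; first by rewrite derivB dp deriv_tailint subrr.
by rewrite hornerD hornerN p1 tailint1 subrr.
Qed.

Lemma unitint_deriv p : unitint p^`() = p.[1] - p.[0].
Proof.
rewrite /unitint -(@tailint_uniq (p.[1]%:P - p)).
- by rewrite hornerD hornerN hornerC.
- by rewrite derivB derivC sub0r.
- by rewrite hornerD hornerN hornerC subrr.
Qed.

Lemma unitintXn n : unitint 'X^n = n.+1%:R^-1.
Proof.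
have := unitint_deriv 'X^(n.+1); rewrite derivXn /= raddfMn !hornerE.
rewrite expr1n expr0n subr0 -[_ *+ _]mulr_natr => /(congr1 (fun x => x / n.+1%:R)).
by rewrite mulfK ?succ_natf_neq0 // mul1r.
Qed.

Lemma unitint_beta a b :
  unitint ('X^a * (1 - 'X) ^+ b) = ((a + b).+1%:R * 'C(a + b, a)%:R)^-1.
Proof.
elim: b a => [|b IHb] a.
  by rewrite expr0 mulr1 addn0 binn mulr1 unitintXn.
(* Integration by parts: ['X^(a.+1) * (1 - 'X) ^+ b.+1] vanishes at both ends. *)
have E : a.+1%:R * unitint ('X^a * (1 - 'X) ^+ b.+1)
         = b.+1%:R * unitint ('X^(a.+1) * (1 - 'X) ^+ b).
  have := unitint_deriv ('X^(a.+1) * (1 - 'X) ^+ b.+1).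
  rewrite [(_ * _).[1]]hornerM [(_ * _).[0]]hornerM !hornerE subrr.
  rewrite !expr0n /= mulr0 mul0r subrr.
  rewrite derivM derivXn deriv_exp derivB derivC derivX sub0r /= mulN1r mulNrn.
  rewrite mulrN mulrnAl mulrnAr raddfB !raddfMn /= => /eqP.
  by rewrite addr_eq0 mulNrn opprK -[_ *+ a.+1]mulr_natl -[_ *+ b.+1]mulr_natl => /eqP.
rewrite {}IHb in E.
apply: (mulfI (succ_natf_neq0 a)); rewrite E addSn addnS.
have C : (a.+1 * 'C((a + b).+1, a.+1) = b.+1 * 'C((a + b).+1, a))%N.
  by rewrite mul_bin_left subSn ?leq_addr // addKn.
have Cn0 c : (c <= (a + b).+1)%N -> 'C((a + b).+1, c)%:R != 0 :> k.
  by rewrite -bin_gt0 => C0; rewrite -(prednK C0) succ_natf_neq0.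
have [le1 le2] : (a < (a + b).+1)%N /\ (a <= (a + b).+1)%N.
  by split; [rewrite ltnS leq_addr | apply: leqW; rewrite leq_addr].
apply/eqP; rewrite eqr_div ?mulf_neq0 ?succ_natf_neq0 ?Cn0 //.
by apply/eqP; rewrite mulrCA [RHS]mulrCA; congr (_ * _); rewrite -!natrM C.
Qed.

(** The integral of s_1^(a_1 - 1) ... s_n^(a_n - 1) over x <= s_1 <= ... <= s_n <= 1,
    for w = a_1 ... a_n, as a polynomial in x. *)
Fixpoint chen (w : seq nat) : {poly k} :=
  if w is a :: w' then tailint ('X^(a.-1) * chen w') else 1.

Lemma deriv_chen a w : (chen (a :: w))^`() = - ('X^(a.-1) * chen w).
Proof. exact: deriv_tailint. Qed.

Lemma chen_cons1 a w : (chen (a :: w)).[1] = 0.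
Proof. exact: tailint1. Qed.

(** Each integration by parts absorbs the first letter into the exponent and releases the inverse of
    a partial sum. These are the products in [xi_coef]. *)
Lemma unitint_chen m w : (0 < m)%N -> all (leq 1) w ->
  unitint ('X^(m.-1) * chen w)
  = \prod_(j < (size w).+1) (m + sumn (take j w))%:R^-1.
Proof.
elim: w m => [|a w IHw] [|m] // _ /=.
  by rewrite mulr1 unitintXn big_ord1 addn0.
case/andP=> a0 w0; rewrite big_ord_recl /= addn0.
under eq_bigr => j _ do rewrite addnA.
rewrite -(IHw (m.+1 + a)%N) //.
have := unitint_deriv ('X^(m.+1) * chen (a :: w)).
rewrite [(_ * _).[1]]hornerM [(_ * _).[0]]hornerM chen_cons1 mulr0.
rewrite hornerXn expr0n mul0r subrr derivM derivXn deriv_chen /=.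
rewrite mulrnAl mulrN mulrA -exprD raddfB raddfMn /= => /eqP.
rewrite subr_eq0 => /eqP E; have -> : (m + a)%N = (m.+1 + a.-1)%N.
  by rewrite addSnnS prednK.
by rewrite -E -[unitint _ *+ _]mulr_natl mulKf ?succ_natf_neq0.
Qed.

End TailIntegral.

(** * Shuffles *)

Section Colorings.

Lemma big_lift_perm (R : nmodType) n (F : 'S_n.+1 -> R) :
  \sum_rho F rho = \sum_m \sum_(rho : 'S_n) F (lift_perm ord0 m rho).
Proof.
rewrite pair_big /=.
rewrite (reindex (fun p : 'I_n.+1 * 'S_n => lift_perm ord0 p.1 p.2)) //=.
apply: onW_bij; apply: inj_card_bij => [[m s] [m' s'] /= E|]; last first.
  by rewrite card_prod card_ord !card_Sn factS.
have em : m = m' by rewrite -(lift_perm_id ord0 m s) E lift_perm_id.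
congr pair => //; apply/permP => x; apply: (@lift_inj _ m).
by rewrite -(lift_perm_lift ord0) E em lift_perm_lift.
Qed.

Lemma big_lift_perm0 (R : nmodType) n (F : 'S_n.+1 -> R) :
  \sum_(rho : 'S_n.+1 | rho ord0 == ord0) F rho
  = \sum_(rho : 'S_n) F (lift_perm ord0 ord0 rho).
Proof.
rewrite big_mkcond big_lift_perm (bigD1 ord0) //= [X in _ + X]big1 ?addr0.
  by apply: eq_bigr => rho _; rewrite lift_perm_id eqxx.
move=> m m0; rewrite big1 // => rho _.
by rewrite lift_perm_id (negPf m0).
Qed.

(** Applied to the inverse of [rho], this says that the word rearranged by [rho] keeps the letters
    of each colour in order: it is a shuffle of the colour words. *)
Definition increasing_on_colors n (c : nat -> nat) (tau : 'S_n) :=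
  [forall a : 'I_n, forall b : 'I_n,
     (a < b)%N && (c a == c b) ==> (tau a < tau b)%N].

Definition first_of_color n (c : nat -> nat) (m : 'I_n) :=
  [forall a : 'I_n, (a < m)%N ==> (c a != c m)].

Lemma ltn_bump2 h a b : (bump h a < bump h b)%N = (a < b)%N.
Proof. by rewrite !ltnNge leq_bump2. Qed.

(** The letter [m] opens the shuffle, so no earlier letter may share its colour; [bump m] renumbers
    the letters that remain. *)
Lemma increasing_on_colors_lift n (c : nat -> nat) (m : 'I_n.+1) (tau : 'S_n) :
  increasing_on_colors c (lift_perm m ord0 tau)
  = first_of_color c m && increasing_on_colors (c \o bump m) tau.
Proof.
apply/idP/andP => [/forallP H|[/forallP Hm /forallP H]].
  split; apply/forallP => a.
    apply/implyP => am; apply/negP => cam.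
    by have := implyP (forallP (H a) m); rewrite am cam lift_perm_id => /(_ isT).
  apply/forallP => b; apply/implyP => /andP[ab cab].
  have := implyP (forallP (H (lift m a)) (lift m b)).
  move/eqP: cab => /= cab.
  by rewrite !lift_perm_lift /= ltn_bump2 ab cab eqxx => /(_ isT).
apply/forallP => a; apply/forallP => b; apply/implyP => /andP[].
case: (unliftP m b) => [b' ->|-> am /eqP cam]; last first.
  by have := implyP (Hm a) am; rewrite cam eqxx.
case: (unliftP m a) => [a' ->|->]; rewrite ?lift_perm_id !lift_perm_lift //=.
rewrite ltn_bump2 => ab cab.
by have := implyP (forallP (H a') b'); rewrite ab /= cab => /(_ isT).
Qed.

Definition color_word n (w c : nat -> nat) (l : nat) : seq nat :=
  [seq w a | a <- iota 0 n & c a == l].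

Lemma iotaS_bump n m : (m <= n)%N ->
  iota 0 n.+1 = iota 0 m ++ m :: iota m.+1 (n - m)
  /\ map (bump m) (iota 0 n) = iota 0 m ++ iota m.+1 (n - m).
Proof.
move=> le_mn; split.
  by rewrite -[m in RHS]add0n -[in LHS](subnKC le_mn) -addnS iotaD.
rewrite -[in LHS](subnKC le_mn) iotaD map_cat add0n; congr (_ ++ _).
  rewrite -[RHS]map_id; apply/eq_in_map => i; rewrite mem_iota /= => im.
  by rewrite /bump leqNgt im.
rewrite -(addn1 m) addnC iotaDl; apply/eq_in_map => i; rewrite mem_iota.
by case/andP=> mi _; rewrite /bump mi.
Qed.

Lemma color_word_bump n (w c : nat -> nat) (m : 'I_n.+1) l :
  first_of_color c m ->
  color_word n.+1 w c l
  = (if l == c m then [:: w m] else [::])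
    ++ color_word n (w \o bump m) (c \o bump m) l.
Proof.
move=> /forallP Hm; have [E1 E2] := iotaS_bump (leq_ord m).
rewrite /color_word E1 -[RHS]/(_ ++ map (w \o bump m) _) map_comp.
rewrite -[filter _ (iota 0 n)]/(filter (preim (bump m) [pred a | c a == l]) _).
rewrite -filter_map E2 !filter_cat /= !map_cat [l == _]eq_sym.
case: eqP => [<-|] //=; rewrite (_ : filter _ _ = [::]) //=.
apply/eqP; rewrite -[_ == _]negbK -has_filter; apply/negP => /hasP[a].
rewrite mem_iota /= add0n => am /eqP cam.
have an := ltn_trans am (ltn_ord m).
by have := implyP (Hm (Ordinal an)) am; rewrite /= cam eqxx.
Qed.

Lemma first_of_color_inj n (c : nat -> nat) (m m' : 'I_n) :
  first_of_color c m -> first_of_color c m' -> c m = c m' -> m = m'.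
Proof.
move=> /forallP H /forallP H' e; apply/val_inj; case: (ltngtP m m') => // lt_m.
  by have := implyP (H' m) lt_m; rewrite e eqxx.
by have := implyP (H m') lt_m; rewrite e eqxx.
Qed.

Lemma first_of_color_exists n (c : nat -> nat) (a : 'I_n) :
  exists2 m : 'I_n, first_of_color c m & c m = c a.
Proof.
case: (@arg_minnP _ a (fun m : 'I_n => c m == c a) (@nat_of_ord n)) => //.
move=> m /eqP cm Hm; exists m => //; apply/forallP => b; apply/implyP => bm.
by apply/negP => /eqP cb; move: bm; rewrite ltnNge Hm // cb cm.
Qed.

Lemma color_word_nil n (w c : nat -> nat) l :
  (forall m : 'I_n, first_of_color c m -> c m != l) -> color_word n w c l = [::].
Proof.
move=> H; rewrite /color_word (_ : filter _ _ = [::]) //.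
apply/eqP; rewrite -[_ == _]negbK -has_filter; apply/negP => /hasP[a].
rewrite mem_iota /= add0n => an /eqP ca.
have [m Hm cm] := first_of_color_exists c (Ordinal an).
by have := H m Hm; rewrite cm /= ca eqxx.
Qed.

Lemma deriv_prod (R : comNzRingType) n (F : 'I_n -> {poly R}) :
  (\prod_i F i)^`() = \sum_i (F i)^`() * \prod_(j | j != i) F j.
Proof.
suff H (r : seq 'I_n) : uniq r -> (\prod_(i <- r) F i)^`()
    = \sum_(i <- r) (F i)^`() * \prod_(j <- r | j != i) F j.
  by rewrite (H _ (index_enum_uniq _)).
elim: r => [|i r IHr] /=; first by rewrite !big_nil derivC.
case/andP=> ir ur; rewrite !big_cons derivM IHr // eqxx /=; congr (_ + _).
  congr (_ * _); rewrite big_seq_cond [RHS]big_seq_cond.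
  apply: eq_bigl => j; case: eqP => [->|]; rewrite ?andbT //.
  by rewrite (negPf ir).
rewrite mulr_sumr big_seq [RHS]big_seq; apply: eq_bigr => j jr.
rewrite mulrCA; congr (_ * _); rewrite big_cons ifT //.
by apply: contraNneq ir => ->.
Qed.

Variables (k : fieldType) (char0 : [pchar k] =i pred0).
Local Notation chen := (@chen k).

(** A product of simplices is the union of the simplices of all shuffles. *)
Lemma sum_chen_color n K (w c : nat -> nat) : (forall a, c a < K)%N ->
  \sum_(rho : 'S_n | increasing_on_colors c rho^-1%g)
     chen [seq w (val (rho a)) | a <- enum 'I_n]
  = \prod_(l < K) chen (color_word n w c l).
Proof.
elim: n w c => [|n IHn] w c cK.
  rewrite (bigD1 1%g) /=; last by apply/forallP => -[].
  rewrite big1 => [|s /andP[_ /eqP []]]; last by apply/permP => -[].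
  by rewrite addr0 enum_ord0 /= big1.
(* Compare derivatives and values at 1. Differentiation strips the first letter on the left and, by
   the Leibniz rule, the head of one colour word on the right. *)
apply/eqP; rewrite -subr_eq0; apply/eqP; apply: poly_deriv0_horner1_eq0 => //.
  have IH (m : 'I_n.+1) := IHn (w \o bump m) (c \o bump m) (fun a => cK _).
  rewrite big_mkcond big_lift_perm derivB.
  transitivity (- (\sum_(m : 'I_n.+1 | first_of_color c m)
     'X^((w m).-1) * \prod_(l < K) chen (color_word n (w \o bump m) (c \o bump m) l))
     - (\prod_(l < K) chen (color_word n.+1 w c l))^`()).
    congr (_ - _); rewrite raddf_sum -sumrN [RHS]big_mkcond; apply: eq_bigr => m _.
    rewrite -IH big_distrr /= -sumrN raddf_sum /= [in RHS]big_mkcond.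
    case: ifP => Hm; last first.
      by rewrite big1 // => rho _; rewrite lift_permV increasing_on_colors_lift Hm raddf0.
    apply: eq_bigr => rho _; rewrite lift_permV increasing_on_colors_lift Hm /=.
    case: ifP => _; last by rewrite raddf0.
    rewrite enum_ordSl /= deriv_chen // lift_perm_id -map_comp.
    by under eq_map => a do rewrite /= lift_perm_lift.
  rewrite deriv_prod -opprD; apply/eqP; rewrite oppr_eq0; apply/eqP.
  rewrite (partition_big (fun m : 'I_n.+1 => Ordinal (cK m)) predT) //=.
  rewrite -big_split /=; apply: big1 => l _.
  (* Either colour [l] occurs, and its unique first letter matches the two terms, or its word is
     empty and both terms vanish. *)
  case: (pickP [pred m : 'I_n.+1 | first_of_color c m & Ordinal (cK m) == l]) => [m|Hl].
    case/andP=> Hm /eqP cm; rewrite (big_pred1 m) => [|m']; last first.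
      apply/andP/eqP => [[Hm' /eqP cm']|->]; last by rewrite cm.
      by apply: first_of_color_inj Hm' Hm _; have := congr1 val (etrans cm' (esym cm)).
    have cml : c m = l by rewrite -cm.
    rewrite (bigD1 l) //= (color_word_bump _ _ Hm) cml eqxx /= deriv_chen //.
    rewrite mulNr mulrA; apply/eqP; rewrite subr_eq0; apply/eqP; congr (_ * _).
    apply: eq_bigr => j jl; rewrite (color_word_bump _ _ Hm) cml.
    by rewrite (_ : (j == l :> nat) = false) //; apply/negbTE.
  rewrite big_pred0 ?add0r; last exact: Hl.
  rewrite color_word_nil ?derivC ?mul0r // => m Hm.
  by have := Hl m; rewrite /= Hm -val_eqE /= => ->.
(* At 1 the iterated integral of a nonempty word is zero: every word on the left is nonempty, and on
   the right so is the word with the colour of letter 0. *)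
rewrite hornerD hornerN horner_sum big1 ?sub0r => [|rho _]; last first.
  by rewrite enum_ordSl /= chen_cons1.
apply/eqP; rewrite oppr_eq0 horner_prod.
have [m Hm cm] := first_of_color_exists c (ord0 : 'I_n.+1).
rewrite (bigD1 (Ordinal (cK m))) //= (color_word_bump _ _ Hm) eqxx /=.
by rewrite chen_cons1 mul0r.
Qed.

End Colorings.

(** * Cutting a word into pieces *)

Section CutSequences.

Fixpoint bitseqs (m : nat) : seq bitseq :=
  if m is m'.+1 then map (rcons^~ true) (bitseqs m') ++ map (rcons^~ false) (bitseqs m')
  else [:: [::]].

Lemma size_bitseqs m b : b \in bitseqs m -> size b = m.
Proof.
elim: m b => [|m IHm] b; first by rewrite inE => /eqP ->.
by rewrite mem_cat => /orP[] /mapP[b' /IHm <- ->]; rewrite size_rcons.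
Qed.

Lemma count_bitseqs m b : b \in bitseqs m -> (count id b <= m)%N.
Proof. by move/size_bitseqs <-; apply: count_size. Qed.

Lemma big_bitseqsS (R : nmodType) m (P : pred bitseq) (F : bitseq -> R) :
  \sum_(b <- bitseqs m.+1 | P b) F b
  = \sum_(b <- bitseqs m | P (rcons b true)) F (rcons b true)
    + \sum_(b <- bitseqs m | P (rcons b false)) F (rcons b false).
Proof. by rewrite big_cat !big_map. Qed.

(** The bit [b`_a] says whether the word is cut just before its letter [a];
    the colors then number the pieces, the first of which may be empty. *)
Definition cut_color (b : bitseq) (a : nat) := count id (take a.+1 b).

Lemma cut_color_le b a : (cut_color b a <= count id b)%N.
Proof. by rewrite -[b in X in (_ <= X)%N](cat_take_drop a.+1) count_cat leq_addr. Qed.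

Lemma cut_color_rcons b x a : (a < size b)%N ->
  cut_color (rcons b x) a = cut_color b a.
Proof. by move=> lt_a; rewrite /cut_color -cats1 takel_cat. Qed.

Lemma count_rcons b (x : bool) : count id (rcons b x) = (count id b + x)%N.
Proof. by rewrite -cats1 count_cat /= addn0. Qed.

Lemma cut_color_last b x : cut_color (rcons b x) (size b) = (count id b + x)%N.
Proof. by rewrite /cut_color take_oversize ?size_rcons // count_rcons. Qed.

Lemma cut_colorS b a : (a.+1 < size b)%N ->
  cut_color b a.+1 = (cut_color b a + nth false b a.+1)%N.
Proof.
by move=> lt_a; rewrite /cut_color (take_nth false) // -cats1 count_cat /= addn0.
Qed.

Lemma color_word_cut_rcons w z b x l : size b = size w ->
  color_word (size w).+1 (nth 0%N (rcons w z)) (cut_color (rcons b x)) l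
  = color_word (size w) (nth 0%N w) (cut_color b) l
    ++ (if (count id b + x)%N == l then [:: z] else [::]).
Proof.
move=> sb; rewrite /color_word -addn1 iotaD filter_cat map_cat add0n; congr (_ ++ _).
  rewrite (eq_in_filter (a2 := fun a => cut_color b a == l)); last first.
    by move=> a; rewrite mem_iota => /andP[_ lt_a]; rewrite cut_color_rcons ?sb.
  apply/eq_in_map => a; rewrite mem_filter mem_iota => /and3P[_ _ lt_a].
  by rewrite nth_rcons lt_a.
by rewrite /= -sb cut_color_last; case: eqP => //= _; rewrite nth_rcons sb ltnn eqxx.
Qed.

Lemma color_word_cut_nil w b l : (count id b < l)%N ->
  color_word (size w) (nth 0%N w) (cut_color b) l = [::].
Proof.
move=> lt_l; apply: color_word_nil => m _; rewrite neq_ltn.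
by rewrite (leq_ltn_trans (cut_color_le _ _)).
Qed.

Variables (k : fieldType) (char0 : [pchar k] =i pred0).
Local Notation chen := (@chen k).

(** The sum over all ways of cutting [w] into [j + 1] pieces, the last [j] of
    which are nonempty. *)
Fixpoint kappa (j : nat) (w : seq nat) : {poly k} :=
  if j is j'.+1
  then \sum_(i < size w) kappa j' (take i w) * chen (drop i w)
  else chen w.

Lemma kappa_eq0 j w : (size w < j)%N -> kappa j w = 0.
Proof.
elim: j w => // j IHj w /=; rewrite ltnS => le_wj; apply: big1 => i _.
by rewrite IHj ?mul0r // size_take ltn_ord (leq_trans (ltn_ord i)).
Qed.

(** This is [kappa] with a fixed word [v] glued to the last piece, a generalisation that lets the
    induction on the last letter push an uncut letter into [v]. *)
Definition kappa_suffix (j : nat) (w v : seq nat) : {poly k} :=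
  if j is j'.+1
  then \sum_(i < size w) kappa j' (take i w) * chen (drop i w ++ v)
  else chen (w ++ v).

Lemma kappa_suffix_nil j w : kappa_suffix j w [::] = kappa j w.
Proof.
by case: j => [|j] /=; rewrite ?cats0 //; under eq_bigr => i _ do rewrite cats0.
Qed.

Lemma sum_cuts_suffix j w v :
  \sum_(b <- bitseqs (size w) | count id b == j)
     (\prod_(l < j) chen (color_word (size w) (nth 0%N w) (cut_color b) l))
     * chen (color_word (size w) (nth 0%N w) (cut_color b) j ++ v)
  = kappa_suffix j w v.
Proof.
elim/last_ind: w j v => [|w z IHw] j v.
  rewrite /= big_mkcond big_seq1 /=; case: j => [|j] /=; last by rewrite big_ord0.
  by rewrite big_ord0 mul1r.
rewrite size_rcons big_bitseqsS.
(* No cut before [z]: it joins the last piece, hence moves into the suffix. *)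
have -> : \sum_(b <- bitseqs (size w) | count id (rcons b false) == j)
     (\prod_(l < j) chen (color_word (size w).+1 (nth 0%N (rcons w z))
                             (cut_color (rcons b false)) l))
     * chen (color_word (size w).+1 (nth 0%N (rcons w z))
               (cut_color (rcons b false)) j ++ v) = kappa_suffix j w (z :: v).
  rewrite -IHw big_seq_cond [RHS]big_seq_cond.
  apply: eq_big => [b|b /andP[/size_bitseqs sb]].
    by rewrite count_rcons addn0.
  rewrite count_rcons addn0 => /eqP cb.
  rewrite !color_word_cut_rcons // addn0 cb eqxx -catA; congr (_ * _).
  apply: eq_bigr => l _; rewrite color_word_cut_rcons // addn0 cb.
  by rewrite gtn_eqF ?cats0.
case: j => [|j].
  rewrite big_seq_cond big1 ?add0r => [|b]; first by rewrite /= cat_rcons.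
  by rewrite count_rcons addn1 andbF.
(* A cut before [z]: the last piece is exactly [z :: v], and the remaining word has one cut
   fewer. *)
have -> : \sum_(b <- bitseqs (size w) | count id (rcons b true) == j.+1)
     (\prod_(l < j.+1) chen (color_word (size w).+1 (nth 0%N (rcons w z))
                             (cut_color (rcons b true)) l))
     * chen (color_word (size w).+1 (nth 0%N (rcons w z))
               (cut_color (rcons b true)) j.+1 ++ v)
  = kappa_suffix j w [::] * chen (z :: v).
  rewrite -IHw big_distrl /= big_seq_cond [RHS]big_seq_cond.
  apply: eq_big => [b|b /andP[/size_bitseqs sb]].
    by rewrite count_rcons addn1.
  rewrite count_rcons addn1 eqSS => /eqP cb.
  rewrite !color_word_cut_rcons // addn1 cb eqxx color_word_cut_nil ?cb //=.
  congr (_ * _); rewrite big_ord_recr /= color_word_cut_rcons // addn1 cb.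
  rewrite gtn_eqF //; congr (_ * _); apply: eq_bigr => l _.
  by rewrite color_word_cut_rcons // addn1 cb gtn_eqF ?cats0 // leqW.
rewrite kappa_suffix_nil /= size_rcons big_ord_recr /= -cats1.
rewrite take_size_cat // drop_size_cat // addrC; congr (_ + _).
by apply: eq_bigr => i _; rewrite takel_cat 1?ltnW // drop_cat ltn_ord -catA.
Qed.

Lemma sum_cuts_chen j n w : (size w < n)%N ->
  \sum_(b <- bitseqs (size w) | count id b == j)
     \prod_(l < n) chen (color_word (size w) (nth 0%N w) (cut_color b) l)
  = kappa j w.
Proof.
move=> lt_wn; case: (ltnP (size w) j) => [lt_wj|le_jw].
  rewrite kappa_eq0 // big_seq_cond big1 // => b /andP[/count_bitseqs le_b].
  by move/eqP=> cb; move: lt_wj; rewrite -cb ltnNge le_b.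
have lt_jn := leq_ltn_trans le_jw lt_wn.
rewrite -kappa_suffix_nil -sum_cuts_suffix; apply: eq_bigr => b /eqP cb.
(* Colours above [j] have empty words and contribute 1, so one bound [n] serves every number of
   cuts. *)
rewrite cats0 -(subnKC lt_jn) big_split_ord /= [X in _ * X]big1 ?mulr1 => [|l _].
  by rewrite big_ord_recr.
by rewrite color_word_cut_nil // cb ltnS leq_addr.
Qed.

End CutSequences.

(** * The coefficients of xi *)

Section XiCoefficient.
Variables (k : fieldType) (char0 : [pchar k] =i pred0).
Local Notation chen := (@chen k).
Local Notation kappa := (@kappa k).

(** In the expanded product a factor [1 - 'X] leaves the choice whether to cut, while [- 'X] forces
    a cut: [b] runs over the cut sets containing [d]. *)
Lemma prod_des_poly (d : bitseq) :
  \prod_(x <- d) (if x then - 'X else 1 - 'X) =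
  \sum_(b <- bitseqs (size d) | all (fun p => p.1 ==> p.2) (zip d b))
     (- 'X) ^+ count id b :> {poly k}.
Proof.
elim/last_ind: d => [|d x IHd].
  by rewrite big_nil big_mkcond big_seq1 /= expr0.
rewrite big_rcons /= IHd size_rcons big_bitseqsS mulrC.
have E y : \sum_(b <- bitseqs (size d) |
     all (fun p => p.1 ==> p.2) (zip (rcons d x) (rcons b y))) (- 'X) ^+ count id (rcons b y)
  = (if x ==> y then (- 'X) ^+ y else 0) * \sum_(b <- bitseqs (size d)
    | all (fun p => p.1 ==> p.2) (zip d b)) (- 'X) ^+ count id b :> {poly k}.
  rewrite mulr_sumr big_seq_cond [RHS]big_seq_cond.
  under eq_bigl => b.
    have -> : (b \in bitseqs (size d)) && all (fun p => p.1 ==> p.2) (zip (rcons d x) (rcons b y))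
       = (b \in bitseqs (size d)) && all (fun p => p.1 ==> p.2) (zip d b) && (x ==> y).
      case: (boolP (b \in _)) => //= /size_bitseqs sb.
      by rewrite zip_rcons // all_rcons andbC.
    over.
  case: (x ==> y); last first.
    rewrite big_pred0 => [|b]; last by rewrite andbF.
    by rewrite big1 // => b _; rewrite mul0r.
  under eq_bigl do rewrite andbT.
  by apply: eq_bigr => b _; rewrite count_rcons exprD mulrC.
rewrite !{}E /= expr0 expr1 -mulrDl; congr (_ * _); case: x => /=.
  by rewrite addr0.
by rewrite addrC.
Qed.

(** Integrating the expansion above term by term gives the sum of [(-1)^j / (j+1)] over those cut
    sets, so the descent coefficient of [xi] is such a sum. *)
Lemma unitint_des_poly (d : bitseq) :
  unitint (\prod_(x <- d) (if x then - 'X else 1 - 'X) : {poly k})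
  = (size d).+1%:R^-1 * ((-1) ^+ count id d / 'C(size d, count id d)%:R).
Proof.
have -> : \prod_(x <- d) (if x then - 'X else 1 - 'X) =
    (-1) ^+ count id d *: ('X^(count id d) * (1 - 'X) ^+ (size d - count id d)) :> {poly k}.
  elim: d => [|x d IHd]; first by rewrite big_nil /= expr0 scale1r mul1r.
  rewrite big_cons {}IHd /=; case: x => /=.
    rewrite add1n subSS !exprS mulN1r scaleNr mulNr; congr (- _).
    by rewrite -scalerAr mulrA.
  by rewrite add0n subSn ?count_size // exprS -scalerAr mulrCA.
rewrite linearZ /= unitint_beta // subnKC ?count_size //.
by rewrite invfM mulrCA.
Qed.

(** A piece is increasing as soon as its adjacent letters are, so the condition is that every
    descent is cut. *)
Lemma descents_lift (m : nat) (tau : 'S_m) (b : bitseq) : size b = m ->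
  let d := [seq (lift_perm ord0 ord0 tau (lift ord0 l)
           < lift_perm ord0 ord0 tau (widen_ord (leqnSn m) l))%N | l <- enum 'I_m] in
  all (fun p => p.1 ==> p.2) (zip d b) = increasing_on_colors (cut_color b) tau.
Proof.
move=> sb d; have sd : size d = m by rewrite size_map size_enum_ord.
have nth_d (l : 'I_m) : nth false d l = (lift_perm ord0 ord0 tau (lift ord0 l)
           < lift_perm ord0 ord0 tau (widen_ord (leqnSn m) l))%N.
  by rewrite (nth_map l) ?size_enum_ord // nth_ord_enum.
have nth_dS (l l' : 'I_m) : l' = l.+1 :> nat -> nth false d l' = (tau l' < tau l)%N.
  move=> e; rewrite nth_d lift_perm_lift.
  rewrite (_ : widen_ord _ _ = lift ord0 l); last by apply/val_inj; rewrite /= e.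
  by rewrite lift_perm_lift.
(* No descent starts at the fixed first letter, so a cut before letter 0 is optional; it makes the
   first piece empty. *)
have d0 (l : 'I_m) : l = 0%N :> nat -> nth false d l = false.
  move=> e; rewrite nth_d (_ : widen_ord _ _ = ord0); last exact/val_inj.
  by rewrite lift_perm_id.
apply/(all_nthP (false, false))/forallP => [H a|H l].
  have {}H l : (l < m)%N -> nth false d l -> nth false b l.
    move=> lt_l dl; have := H l; rewrite size_zip sd sb minnn => /(_ lt_l).
    by rewrite nth_zip ?sd //= dl.
  apply/forallP => [[c cm]]; apply/implyP => /andP[/= ac /= cc].
  (* Equal colours at [a] and [c.+1] exclude cuts in between, hence descents; the induction chains
     the ascents. *)
  elim: c cm ac cc => // c IHc cm; rewrite ltnS => le_ac cc.
  have cc' : cut_color b c = cut_color b c.+1.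
    apply/eqP; rewrite eqn_leq -{2}(eqP cc) cut_colorS ?sb // leq_addr /=.
    by rewrite /cut_color -(subnKC le_ac) -addSn takeD count_cat leq_addr.
  have nd : nth false d c.+1 = false.
    apply/negP => /(H _ cm) bc; move: cc'; rewrite cut_colorS ?sb // bc => /eqP.
    by rewrite -{1}[cut_color _ _]addn0 eqn_add2l.
  have lt_c : (tau (Ordinal (ltnW cm)) < tau (Ordinal cm))%N.
    have := nth_dS (Ordinal (ltnW cm)) (Ordinal cm) erefl; rewrite nd.
    move/esym/negbT; rewrite -leqNgt leq_eqVlt => /orP[|//].
    move/eqP/val_inj/perm_inj => /(congr1 val) /= e.
    by have /eqP := e; rewrite eqn_leq ltnn andbF.
  move: le_ac; rewrite leq_eqVlt => /orP[/eqP ac|ac].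
    by rewrite (_ : a = Ordinal (ltnW cm)) //; apply/val_inj.
  by apply: ltn_trans (IHc _ ac _) lt_c; rewrite cc'.
rewrite size_zip sd sb minnn => lt_l; rewrite nth_zip ?sd //=; apply/implyP => dl.
(* An uncut descent would put two adjacent letters of one colour in the wrong order. *)
apply: contraT => /negbTE bl; case: l lt_l dl bl => [|l] lt_l dl bl.
  by rewrite (d0 (Ordinal lt_l)) in dl.
have := nth_dS (Ordinal (ltnW lt_l)) (Ordinal lt_l) erefl; rewrite dl.
have := implyP (forallP (H (Ordinal (ltnW lt_l))) (Ordinal lt_l)).
rewrite /= leqnn cut_colorS ?sb // bl addn0 eqxx => /(_ isT) /ltnW.
by rewrite leqNgt => /negbTE ->.
Qed.

Lemma sum_ord_le_take n (F : 'I_n -> nat) j :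
  (\sum_(l < n | (l < j)%N) F l = sumn (take j [seq F l | l <- enum 'I_n]))%N.
Proof.
elim: n F j => [|n IHn] F j; first by rewrite big_ord0 enum_ord0.
rewrite big_mkcond big_ord_recl enum_ordSl /= -map_comp.
case: j => [|j] /=; first by rewrite big1.
by rewrite -IHn [in RHS]big_mkcond.
Qed.

(** There are at most [m] cuts, so every [K] above [m] gives the same sum; this allows a common [K]
    for all words of a given weight. *)
Lemma xi_coef_kappa m (t : m.+1.-tuple nat) i w K : tval t = i :: w ->
  all (leq 1) t -> (m < K)%N ->
  xi_coef k t
  = \sum_(j < K) ((-1) ^+ j / j.+1%:R) * unitint ('X^(i.-1) * kappa j w).
Proof.
move=> tE; rewrite tE => /= /andP[i0 w0] lt_mK.
have sw : size w = m by have := size_tuple t; rewrite tE => -[].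
have t0 : tnth t ord0 = i by rewrite (tnth_nth 0%N) tE.
have tS (a : 'I_m) : tnth t (lift ord0 a) = nth 0%N w a.
  by rewrite (tnth_nth 0%N) tE.
rewrite /xi_coef big_lift_perm0 mulr_sumr.
pose des (rho : 'S_m) := [seq (lift_perm ord0 ord0 rho^-1%g (lift ord0 l)
   < lift_perm ord0 ord0 rho^-1%g (widen_ord (leqnSn m) l))%N | l <- enum 'I_m].
have sdes rho : size (des rho) = m by rewrite size_map size_enum_ord.
(* The descent coefficient becomes a sum over cut sets, the product of partial sums an iterated
   integral. *)
transitivity (\sum_(rho : 'S_m) \sum_(b <- bitseqs m |
     increasing_on_colors (cut_color b) rho^-1%g)
   ((-1) ^+ count id b / (count id b).+1%:R)
   * unitint ('X^(i.-1) * chen [seq nth 0%N w (val (rho a)) | a <- enum 'I_m])).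
  apply: eq_bigr => rho _; rewrite mulrA lift_permV -big_distrl /=; congr (_ * _).
    transitivity (unitint (\prod_(x <- des rho) (if x then - 'X else 1 - 'X : {poly k}))).
      rewrite unitint_des_poly sdes.
      rewrite (_ : descents _ = count id (des rho)) // /descents.
      by rewrite count_map enumT cardE size_filter; apply: eq_count => l; rewrite !inE.
    rewrite prod_des_poly raddf_sum /= sdes big_seq_cond [RHS]big_seq_cond.
    apply: eq_big => [b|b /andP[/size_bitseqs sb _]].
      by case: (boolP (b \in _)) => //= /size_bitseqs sb; rewrite descents_lift.
    by rewrite -scaleN1r exprZn linearZ /= unitintXn.
  rewrite unitint_chen // ; last first.
    apply/allP => _ /mapP[a _ ->]; apply: (allP w0); apply: mem_nth.
    by rewrite sw.
  rewrite size_map size_enum_ord; apply: eq_bigr => j _; congr (_%:R^-1).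
  under eq_bigl do rewrite -ltnS.
  rewrite sum_ord_le_take enum_ordSl /= lift_perm_id t0 -map_comp.
  by under eq_map => a do rewrite /= lift_perm_lift tS.
rewrite (exchange_big_dep predT) //=.
(* For fixed cuts, the sum over the compatible permutations is a product by the shuffle identity. *)
transitivity (\sum_(b <- bitseqs m) ((-1) ^+ count id b / (count id b).+1%:R)
  * unitint ('X^(i.-1) * \prod_(l < K) chen (color_word m (nth 0%N w) (cut_color b) l)) : k).
  rewrite big_seq [RHS]big_seq; apply: eq_bigr => b bm.
  rewrite -sum_chen_color // => [|a]; last first.
    by rewrite (leq_ltn_trans (cut_color_le _ _)) // (leq_ltn_trans (count_bitseqs bm)).
  by rewrite -mulr_sumr -raddf_sum -mulr_sumr.
transitivity (\sum_(b <- bitseqs m) \sum_(j < K | count id b == j)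
  ((-1) ^+ j / j.+1%:R)
  * unitint ('X^(i.-1) * \prod_(l < K) chen (color_word m (nth 0%N w) (cut_color b) l)) : k).
  rewrite big_seq [RHS]big_seq; apply: eq_bigr => b bm.
  have lt_b := leq_ltn_trans (count_bitseqs bm) lt_mK.
  by rewrite [RHS](big_pred1 (Ordinal lt_b)) // => j; rewrite -val_eqE eq_sym.
rewrite (exchange_big_dep predT) //=; apply: eq_bigr => j _.
by rewrite -mulr_sumr -raddf_sum -mulr_sumr -sw sum_cuts_chen // sw.
Qed.

End XiCoefficient.

(** * Compositions of an integer *)

Section Compositions.

(** [m] is fuel, as the recursion passes from [n] to [n - i.+1]. Compositions of [n] are the words
    of weight [n]. *)
Fixpoint comps_rec (m n : nat) : seq (seq nat) :=
  if n is 0 then [:: [::]]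
  else if m is m'.+1
  then flatten [seq map (cons i.+1) (comps_rec m' (n - i.+1)) | i <- iota 0 n]
  else [::].
Definition comps n := comps_rec n n.
Arguments comps : simpl never.

Lemma comps_recS m n : comps_rec m.+1 n.+1
  = flatten [seq map (cons i.+1) (comps_rec m (n - i)) | i <- iota 0 n.+1].
Proof. by []. Qed.

Lemma comps_rec_fuel m n : (n <= m)%N -> comps_rec m n = comps n.
Proof.
rewrite /comps; elim: n {-2}n (leqnn n) m => [|N IHN] n le_nN [|m] // le_nm.
- by case: n le_nN le_nm.
- by case: n le_nN le_nm.
- by case: n le_nN le_nm.
case: n le_nN le_nm => // n; rewrite !ltnS => le_nN le_nm.
rewrite !comps_recS; congr flatten; apply/eq_in_map => i _.
have le_i : (n - i <= N)%N by rewrite (leq_trans (leq_subr _ _)).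
by rewrite (IHN _ le_i m) ?(IHN _ le_i n) ?leq_subr // (leq_trans (leq_subr _ _)).
Qed.

Lemma comps0 : comps 0 = [:: [::]]. Proof. by []. Qed.

Lemma compsS n :
  comps n.+1 = flatten [seq map (cons i.+1) (comps (n - i)) | i <- iota 0 n.+1].
Proof.
rewrite /comps comps_recS; congr flatten; apply/eq_in_map => i _.
by rewrite comps_rec_fuel // leq_subr.
Qed.

Lemma big_compsS (R : nmodType) n (F : seq nat -> R) :
  \sum_(w <- comps n.+1) F w
  = \sum_(i < n.+1) \sum_(w <- comps (n - i)) F (i.+1 :: w).
Proof.
rewrite compsS big_flatten big_map -[iota 0 n.+1]/(index_iota 0 n.+1) big_mkord.
by apply: eq_bigr => i _; rewrite big_map.
Qed.

Lemma mem_comps n w : (w \in comps n) = (sumn w == n) && all (leq 1) w.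
Proof.
elim: w n => [|a w IHw] [|n] //.
- by apply/negP; rewrite compsS => /flattenP[_ /mapP[i _ ->]] /mapP[].
- by rewrite inE /=; case: a => [|a] //; rewrite andbF.
apply/idP/idP => [|/andP[/= /eqP e /andP[a0 w0]]].
  rewrite compsS => /flattenP[_ /mapP[i + ->]] /mapP[w' wc [-> ww]].
  move: wc; rewrite -ww mem_iota add0n ltnS /= IHw => /andP[/eqP -> ->] le_in.
  by rewrite addSn subnKC // eqxx.
case: a a0 e => // a _ [e].
rewrite compsS; apply/flattenP; exists (map (cons a.+1) (comps (n - a))).
  by apply/mapP; exists a => //; rewrite mem_iota add0n ltnS /= -e leq_addr.
by rewrite map_f // IHw w0 -e addKn eqxx.
Qed.

Lemma uniq_comps n : uniq (comps n).
Proof.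
elim: n {-2}n (leqnn n) => [|N IHN] [|n] // le_nN.
rewrite compsS.
have : uniq (iota 0 n.+1) by apply: iota_uniq.
elim: (iota 0 n.+1) => //= i s IHs /andP[is_ us]; rewrite cat_uniq IHs // andbT.
rewrite map_inj_uniq => [|u v [] //]; rewrite IHN ?(leq_trans (leq_subr _ _)) //=.
apply/hasPn => u /flattenP[_ /mapP[j js ->]] /mapP[u' _ ->].
by apply/negP => /mapP[v _ [ij _]]; rewrite -ij js in is_.
Qed.

Lemma big_triangle (R : nmodType) n (G : nat -> nat -> R) :
  \sum_(i < n) \sum_(p < i.+1) G p (i - p)%N
  = \sum_(p < n) \sum_(j < n - p) G p j.
Proof.
elim: n => [|n IHn]; first by rewrite !big_ord0.
transitivity (\sum_(p < n.+1) (\sum_(j < n - p) G p j + G p (n - p)%N)).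
  by rewrite big_split /= !big_ord_recr /= subnn big_ord0 addr0 IHn.
by apply: eq_bigr => p _; rewrite subSn ?leq_ord // big_ord_recr.
Qed.

(** A composition cut in two is a composition of some [p] followed by one of [n - p]; the induction
    peels off the first part of [u]. *)
Lemma big_comps_split (R : nmodType) n (F : seq nat -> seq nat -> R) :
  \sum_(w <- comps n) \sum_(j < (size w).+1) F (take j w) (drop j w)
  = \sum_(p < n.+1) \sum_(u <- comps p) \sum_(v <- comps (n - p)) F u v.
Proof.
elim: n {-2}n (leqnn n) F => [|N IHN] [|n] // le_nN F;
  try by rewrite [RHS]big_ord1 sub0n !comps0 !big_seq1 big_ord1.
rewrite big_compsS [RHS]big_ord_recl comps0 big_seq1 /= subn0 big_compsS.
transitivity (\sum_(i < n.+1) (\sum_(w <- comps (n - i)) F [::] (i.+1 :: w)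
   + \sum_(p < (n - i).+1) \sum_(u <- comps p) \sum_(v <- comps (n - i - p))
       F (i.+1 :: u) v)).
  apply: eq_bigr => i _.
  rewrite -(IHN (n - i)%N _ (fun u v => F (i.+1 :: u) v)); last first.
    by rewrite (leq_trans (leq_subr _ _)).
  by rewrite -big_split; apply: eq_bigr => w _; rewrite big_ord_recl.
rewrite big_split /=; congr (_ + _).
pose G i j := \sum_(u <- comps j) \sum_(v <- comps (n - (i + j))) F (i.+1 :: u) v.
transitivity (\sum_(i < n.+1) \sum_(j < n.+1 - i) G i j).
  apply: eq_bigr => i _; rewrite subSn ?leq_ord //; apply: eq_bigr => j _.
  by rewrite /G subnDA.
rewrite -big_triangle; apply: eq_bigr => p _.
rewrite big_compsS; apply: eq_bigr => i _.
by rewrite /G subnKC ?leq_ord // subSS.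
Qed.

End Compositions.
Arguments comps : simpl never.

(** * Polynomials over a noncommutative algebra, and sequences of them *)

Section Series.
Variables (k : fieldType) (char0 : [pchar k] =i pred0) (A : algType k).

(** The library makes [{poly A}] an [A]-algebra only; the completions of [Defs]
    need a [k]-algebra. *)
Definition polyalg := {poly A}.
HB.instance Definition _ := GRing.NzRing.on polyalg.

Definition polyalg_scale (c : k) (p : polyalg) : polyalg := (c%:A)%:P * p.

Lemma polyalg_scaleA a b p :
  polyalg_scale a (polyalg_scale b p) = polyalg_scale (a * b) p.
Proof.
by rewrite /polyalg_scale mulrA -polyCM -[a%:A * _]scalerAl mul1r scalerA.
Qed.
Lemma polyalg_scale1 : left_id 1 polyalg_scale.
Proof. by move=> p; rewrite /polyalg_scale scale1r polyC1 mul1r. Qed.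
Lemma polyalg_scaleDr : right_distributive polyalg_scale +%R.
Proof. by move=> c p q; rewrite /polyalg_scale mulrDr. Qed.
Lemma polyalg_scaleDl p : {morph polyalg_scale^~ p : a b / a + b}.
Proof. by move=> a b; rewrite /polyalg_scale scalerDl polyCD mulrDl. Qed.

HB.instance Definition _ := GRing.Zmodule_isLmodule.Build k polyalg
  polyalg_scaleA polyalg_scale1 polyalg_scaleDr polyalg_scaleDl.

Lemma polyalg_scalerAl (c : k) (p q : polyalg) : c *: (p * q) = c *: p * q.
Proof. exact: mulrA. Qed.
HB.instance Definition _ :=
  GRing.Lmodule_isLalgebra.Build k polyalg polyalg_scalerAl.

Lemma polyC_alg_comm (c : k) (p : {poly A}) : (c%:A)%:P * p = p * (c%:A)%:P.
Proof.
by apply/polyP => i; rewrite coefCM coefMC mulr_algl mulr_algr.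
Qed.

Lemma polyalg_scalerAr (c : k) (p q : polyalg) : c *: (p * q) = p * (c *: q).
Proof.
rewrite -[LHS]/(_ * (p * q)) -[RHS]/(p * (_ * q)).
by rewrite mulrA [_ * p]polyC_alg_comm mulrA.
Qed.
HB.instance Definition _ :=
  GRing.Lalgebra_isAlgebra.Build k polyalg polyalg_scalerAr.

Definition inpoly (q : {poly k}) : polyalg := map_poly (in_alg A) q.
Definition inconst (x : A) : polyalg := x%:P.
Definition pderiv (p : polyalg) : polyalg := deriv p.
(** The boolean restricts evaluation to 0 and 1, which commute with all coefficients, so evaluation
    is multiplicative. *)
Definition peval (c : bool) (p : polyalg) : A := horner p c%:R.

Lemma inpoly_linear : linear inpoly.
Proof.
move=> c p q; rewrite /inpoly rmorphD /=; congr (_ + _).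
by rewrite -mul_polyC rmorphM /= map_polyC.
Qed.
HB.instance Definition _ :=
  GRing.isLinear.Build k {poly k} polyalg *:%R inpoly inpoly_linear.
Lemma inpoly_monoid : monoid_morphism inpoly.
Proof. by split=> [|p q]; rewrite /inpoly ?rmorph1 ?rmorphM. Qed.
HB.instance Definition _ :=
  GRing.isMonoidMorphism.Build {poly k} polyalg inpoly inpoly_monoid.

Lemma inconst_linear : linear inconst.
Proof.
move=> c p q; rewrite /inconst polyCD; congr (_ + _).
by rewrite -[RHS]/(_ * _) -polyCM -scalerAl mul1r.
Qed.
HB.instance Definition _ :=
  GRing.isLinear.Build k A polyalg *:%R inconst inconst_linear.
Lemma inconst_monoid : monoid_morphism inconst.
Proof. by split=> [|p q]; rewrite /inconst ?polyC1 ?polyCM. Qed.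
HB.instance Definition _ :=
  GRing.isMonoidMorphism.Build A polyalg inconst inconst_monoid.

Lemma inpoly_comm q p : inpoly q * p = p * inpoly q.
Proof.
elim/poly_ind: q => [|q c IHq]; first by rewrite raddf0 mul0r mulr0.
rewrite rmorphD rmorphM /= mulrDl mulrDr; congr (_ + _).
  rewrite -mulrA [inpoly 'X * p](_ : _ = p * inpoly 'X) ?mulrA ?IHq //.
  by rewrite /inpoly map_polyX; apply/esym/commr_polyX.
by rewrite /inpoly map_polyC polyC_alg_comm.
Qed.

Lemma pderiv_linear : linear pderiv.
Proof.
move=> c p q; rewrite /pderiv -[c *: p]/((c%:A)%:P * _) derivD derivM derivC.
by rewrite mul0r add0r.
Qed.
HB.instance Definition _ :=
  GRing.isLinear.Build k polyalg polyalg *:%R pderiv pderiv_linear.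

Lemma pderivM p q : pderiv (p * q) = pderiv p * q + p * pderiv q.
Proof. exact: derivM. Qed.
Lemma pderiv_inpoly q : pderiv (inpoly q) = inpoly q^`().
Proof. by rewrite /pderiv /inpoly deriv_map. Qed.
Lemma pderiv_inconst x : pderiv (inconst x) = 0.
Proof. exact: derivC. Qed.

Lemma peval_linear c : linear (peval c).
Proof.
move=> e p q; rewrite /peval -[e *: p]/((e%:A)%:P * _) hornerD.
by rewrite hornerCM mulr_algl.
Qed.
HB.instance Definition _ c :=
  GRing.isLinear.Build k polyalg A *:%R (peval c) (peval_linear c).

Lemma pevalM c p q : peval c (p * q) = peval c p * peval c q.
Proof.
by rewrite /peval hornerM_comm // /comm_poly; case: c;
  rewrite ?mulr1 ?mul1r ?mulr0 ?mul0r.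
Qed.
Lemma peval_inpoly c q : peval c (inpoly q) = (q.[c%:R])%:A.
Proof. by rewrite /peval /inpoly -(rmorph_nat (in_alg A)) horner_map. Qed.
Lemma peval_inconst c x : peval c (inconst x) = x.
Proof. exact: hornerC. Qed.

Lemma pderiv0_peval1_eq0 p : pderiv p = 0 -> peval true p = 0 -> p = 0.
Proof.
by apply: deriv0_horner1_eq0; apply: (@scaled_mulrn_eq0 k).
Qed.

(** With this trivial weight condition the completion consists of all sequences,
    with the Cauchy product. *)
Definition series := completion (fun (_ : nat) (_ : polyalg) => True).
HB.instance Definition _ := GRing.Algebra.on series.

Definition ser (f : nat -> polyalg) : series :=
  @Completion k polyalg _ f (fun n => wt_gen (I : (fun _ _ => True) n (f n))).

Lemma series_sum (I : Type) (r : seq I) (P : pred I) (F : I -> series) n :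
  (\sum_(i <- r | P i) F i) n = \sum_(i <- r | P i) F i n.
Proof.
by elim/big_rec2: _ => [|i x y _ <-]; [exact: comp0 | exact: compD].
Qed.

End Series.

(** * Series with polynomial coefficients *)

Section SeriesCalculus.
Variables (k : fieldType) (char0 : [pchar k] =i pred0) (A : algType k).
Local Notation inpoly := (inpoly A).

Definition cst (x : polyalg A) : series A := ser (fun n => if n is 0 then x else 0).

Lemma seriesP (u v : series A) : (forall n, u n = v n) -> u = v.
Proof. exact: completionP. Qed.

Lemma series_mulE (u v : series A) n :
  (u * v) n = \sum_(i < n.+1) u i * v (n - i)%N.
Proof. exact: compM. Qed.

Lemma series_mul_rev (u v : series A) n :
  (u * v) n = \sum_(i < n.+1) u (n - i)%N * v i.
Proof. exact: hat_mul_rev. Qed.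

Lemma cst_mull x z n : (cst x * z) n = x * z n.
Proof.
rewrite series_mulE big_ord_recl /= subn0 big1 ?addr0 // => i _.
by rewrite mul0r.
Qed.

Lemma cst_mulr x z n : (z * cst x) n = z n * x.
Proof.
rewrite series_mul_rev big_ord_recl /= subn0 big1 ?addr0 // => i _.
by rewrite mulr0.
Qed.

Lemma cst_inpoly_comm q z : cst (inpoly q) * z = z * cst (inpoly q).
Proof. by apply: seriesP => n; rewrite cst_mull cst_mulr inpoly_comm. Qed.

Lemma cstB x y : cst (x - y) = cst x - cst y.
Proof. by apply: seriesP => -[|n]; rewrite compD compN //= subr0. Qed.

Lemma cstM x y : cst (x * y) = cst x * cst y.
Proof. by apply: seriesP => -[|n]; rewrite cst_mull //= mulr0. Qed.

Definition dser (u : series A) : series A := ser (fun n => pderiv (u n)).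

Lemma dser_linear : linear dser.
Proof. by move=> c u v; apply: seriesP => n /=; rewrite linearP. Qed.
HB.instance Definition _ :=
  GRing.isLinear.Build k (series A) (series A) *:%R dser dser_linear.

Lemma dserM u v : dser (u * v) = dser u * v + u * dser v.
Proof.
apply: seriesP => n; rewrite compD !series_mulE /= raddf_sum -big_split /=.
by apply: eq_bigr => i _; rewrite pderivM.
Qed.

Lemma dser_exp u j :
  dser (u ^+ j.+1) = \sum_(i < j.+1) u ^+ i * dser u * u ^+ (j - i).
Proof.
elim: j => [|j IHj]; first by rewrite big_ord1 expr1 expr0 mulr1 mul1r.
rewrite exprSr dserM IHj [RHS]big_ord_recr /= subnn expr0 mulr1 mulr_suml.
congr (_ + _); apply: eq_bigr => i _.
by rewrite -mulrA -exprSr subSn ?leq_ord.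
Qed.

Lemma dser_cst_inconst x : dser (cst (inconst x)) = 0.
Proof. by apply: seriesP => -[|n] /=; rewrite ?pderiv_inconst ?raddf0. Qed.

Lemma peval_mul c (u v : series A) n :
  peval c ((u * v) n) = \sum_(i < n.+1) peval c (u i) * peval c (v (n - i)%N).
Proof.
by rewrite series_mulE raddf_sum; apply: eq_bigr => i _; exact: pevalM.
Qed.

(** The sum of the [F p], each shifted by the weight [p]. *)
Definition dsum (F : nat -> series A) : series A :=
  ser (fun n => \sum_(p < n.+1) F p (n - p)%N).

Lemma dsumE F n : dsum F n = \sum_(p < n.+1) F p (n - p)%N.
Proof. by []. Qed.

Lemma eq_dsum F G : F =1 G -> dsum F = dsum G.
Proof. by move=> e; apply: seriesP => n; apply: eq_bigr => p _; rewrite e. Qed.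

Lemma dsumB F G : dsum (fun p => F p - G p) = dsum F - dsum G.
Proof.
by apply: seriesP => n; rewrite compD compN /= -sumrB.
Qed.

Lemma dsum_mulr F z : dsum F * z = dsum (fun p => F p * z).
Proof.
apply: seriesP => n; rewrite series_mulE dsumE.
pose G p j := F p j * z (n - (p + j))%N.
transitivity (\sum_(i < n.+1) \sum_(p < i.+1) G p (i - p)%N).
  apply: eq_bigr => i _; rewrite dsumE mulr_suml; apply: eq_bigr => p _.
  by rewrite /G subnKC ?leq_ord.
rewrite big_triangle; apply: eq_bigr => p _.
rewrite subSn ?leq_ord // series_mulE; apply: eq_bigr => j _.
by rewrite /G subnDA.
Qed.

Lemma dsum_mull F z : z * dsum F = dsum (fun p => z * F p).
Proof.
apply: seriesP => n; rewrite series_mul_rev dsumE.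
pose G p j := z (n - (p + j))%N * F p j.
transitivity (\sum_(i < n.+1) \sum_(p < i.+1) G p (i - p)%N).
  apply: eq_bigr => i _; rewrite dsumE mulr_sumr; apply: eq_bigr => p _.
  by rewrite /G subnKC ?leq_ord.
rewrite big_triangle; apply: eq_bigr => p _.
rewrite subSn ?leq_ord // series_mul_rev; apply: eq_bigr => j _.
by rewrite /G subnDA.
Qed.

(** A letter [i >= 1] has weight [i] and carries the factor [s^(i-1)] of [a(s)]; there is no letter
    0. *)
Definition lsum (F : nat -> series A) : series A :=
  dsum (fun p => if p is i.+1 then cst (inpoly 'X^i) * F p else 0).

Lemma lsum0 F : lsum F 0%N = 0.
Proof. by rewrite /= big_ord1. Qed.

Lemma lsumS F n :
  lsum F n.+1 = \sum_(i < n.+1) inpoly 'X^i * F i.+1 (n - i)%N.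
Proof.
rewrite [LHS]big_ord_recl add0r; apply: eq_bigr => i _.
by rewrite -[LHS]/((cst (inpoly 'X^i) * F i.+1) (n.+1 - i.+1)%N) cst_mull subSS.
Qed.

Lemma eq_lsum F G : F =1 G -> lsum F = lsum G.
Proof. by move=> e; apply: eq_dsum => -[|p] //; rewrite e. Qed.

Lemma lsumB F G : lsum (fun p => F p - G p) = lsum F - lsum G.
Proof. by rewrite -dsumB; apply: eq_dsum => -[|p]; rewrite ?subr0 ?mulrBr. Qed.

Lemma lsum_mulr F z : lsum F * z = lsum (fun p => F p * z).
Proof. by rewrite dsum_mulr; apply: eq_dsum => -[|p]; rewrite ?mul0r ?mulrA. Qed.

Lemma lsum_mull F z : z * lsum F = lsum (fun p => z * F p).
Proof.
rewrite dsum_mull; apply: eq_dsum => -[|p]; rewrite ?mulr0 // mulrA.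
by rewrite -cst_inpoly_comm mulrA.
Qed.

Definition vanish_below (N : nat) (u : series A) := forall n, (n < N)%N -> u n = 0.

Lemma vanish_below0 u : vanish_below 0 u. Proof. by []. Qed.

Lemma vanish_belowM M N u v :
  vanish_below M u -> vanish_below N v -> vanish_below (M + N) (u * v).
Proof.
move=> Hu Hv n lt_n; rewrite series_mulE big1 // => i _.
case: (ltnP i M) => [/Hu ->|le_Mi]; rewrite ?mul0r // Hv ?mulr0 //.
by rewrite ltn_subLR ?leq_ord // (leq_trans lt_n) // leq_add2r.
Qed.

Lemma vanish_belowX u j : vanish_below 1 u -> vanish_below j (u ^+ j).
Proof.
move=> Hu; elim: j => [|j IHj]; first exact: vanish_below0.
by rewrite exprS -add1n; apply: vanish_belowM.
Qed.

Lemma vanish_belowZ N c u : vanish_below N u -> vanish_below N (c *: u).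
Proof. by move=> Hu n lt_n; rewrite compZ Hu // scaler0. Qed.

Lemma vanish_below_sum N (I : Type) (r : seq I) (P : pred I) F :
  (forall i, P i -> vanish_below N (F i)) ->
  vanish_below N (\sum_(i <- r | P i) F i).
Proof. by move=> H n lt_n; rewrite series_sum big1 // => i /H; apply. Qed.

(** The common form of the series below: a sum over words, graded by weight, of a polynomial times
    the iterated action of the letters on [c]. *)
Definition wser (phi : seq nat -> {poly k}) (o : A -> nat -> A) (c : A) : series A :=
  ser (fun n => \sum_(w <- comps n) inpoly (phi w) * inconst (foldl o c w)).

(** Differentiating [chen] strips the first letter, and [foldl] lets exactly this letter act first
    on [c]. *)
Lemma dser_wser o c :
  dser (wser (@chen k) o c) = - lsum (fun i => wser (@chen k) o (o c i)).
Proof.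
apply: seriesP => -[|n]; rewrite compN.
  rewrite lsum0 oppr0 /= comps0 big_seq1 pderivM pderiv_inpoly pderiv_inconst.
  by rewrite mulr0 addr0 derivC raddf0 mul0r.
rewrite lsumS -sumrN /= big_compsS raddf_sum; apply: eq_bigr => i _.
rewrite raddf_sum /= mulr_sumr -sumrN; apply: eq_bigr => w _.
rewrite pderivM pderiv_inpoly pderiv_inconst mulr0 addr0 /= deriv_tailint //.
by rewrite raddfN /= rmorphM mulNr mulrA.
Qed.

Lemma wser_chen0 o c : wser (@chen k) o c 0%N = inconst c.
Proof. by rewrite /= comps0 big_seq1 /= rmorph1 mul1r. Qed.

Lemma peval1_wser_chen o c n :
  peval true (wser (@chen k) o c n) = if n is 0 then c else 0.
Proof.
case: n => [|n]; first by rewrite wser_chen0 peval_inconst.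
rewrite /= big_compsS raddf_sum big1 // => i _; rewrite raddf_sum big1 // => w _.
by rewrite [LHS]pevalM peval_inpoly /= tailint1 scale0r mul0r.
Qed.

Variable g : nat -> A.

Definition lmul_op (x : A) (j : nat) : A := g j * x.
Definition ad_op (x : A) (j : nat) : A := g j * x - x * g j.

(** [flow] is y, [vfield] is a, and [adser j c] is Ad_y (Ad_y - 1)^j c. *)
Definition flow : series A := wser (@chen k) lmul_op 1.
Definition vfield : series A := lsum (fun i => cst (inconst (g i))).
Definition adser (j : nat) (c : A) : series A := wser (@kappa k j) ad_op c.

Lemma wser_lmul_op phi c : wser phi lmul_op c = wser phi lmul_op 1 * cst (inconst c).
Proof.
apply: seriesP => n; rewrite cst_mulr /= mulr_suml; apply: eq_bigr => w _.
rewrite -mulrA -rmorphM /=; congr (_ * inconst _).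
elim/last_ind: w => [|w i IHw] /=; first by rewrite mul1r.
by rewrite -!cats1 !foldl_cat /= IHw /lmul_op mulrA.
Qed.

Lemma dser_flow : dser flow = - (flow * vfield).
Proof.
rewrite dser_wser lsum_mull; congr (- _); apply: eq_lsum => i.
by rewrite wser_lmul_op /lmul_op mulr1.
Qed.

Lemma lsum_cst_ad_op c :
  lsum (fun i => cst (inconst (ad_op c i)))
  = vfield * cst (inconst c) - cst (inconst c) * vfield.
Proof.
rewrite lsum_mulr lsum_mull -lsumB; apply: eq_lsum => i.
by rewrite /ad_op raddfB /= !rmorphM cstB !cstM.
Qed.

(** The identity [Ad_y(c) y = y c]. The difference [D c] of its sides vanishes at 1, and its
    derivative in each weight involves only lower weights of such differences. *)
Lemma adser0_flow c : adser 0 c * flow = flow * cst (inconst c).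
Proof.
pose D c := adser 0 c * flow - flow * cst (inconst c).
have dD e : dser (D e) = - lsum (fun i => D (ad_op e i)) - D e * vfield.
  rewrite /D lsumB -lsum_mulr -lsum_mull lsum_cst_ad_op raddfB /= !dserM.
  rewrite dser_wser dser_flow dser_cst_inconst mulr0 addr0.
  rewrite mulrBl mulrBr !mulNr !mulrN !mulrA.
  set p := lsum _ * _; set q := adser 0 e * _ * _.
  set r := flow * vfield * _; set t := flow * _ * vfield.
  rewrite opprK [in RHS](opprB q) [- (p - _)]opprD opprK -!addrA; congr (_ + _).
  by rewrite addKr addrC.
suff H n e : D e n = 0.
  apply: seriesP => n; apply/eqP; rewrite -subr_eq0 -compN -compD.
  by apply/eqP; apply: H.
(* [e] is generalised because the equation passes from [e] to [ad_op e i]. *)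
elim/ltn_ind: n e => n IHn e; apply: (pderiv0_peval1_eq0 char0).
  rewrite -[LHS]/(dser (D e) n) dD compD !compN.
  have -> : lsum (fun i => D (ad_op e i)) n = 0.
    case: n IHn => [|n] IHn; first exact: lsum0.
    by rewrite lsumS big1 // => i _; rewrite IHn ?mulr0 // ltnS leq_subr.
  rewrite oppr0 add0r series_mulE big1 ?oppr0 // => i _.
  case: (ltnP i n) => [lt_in|le_ni]; first by rewrite IHn ?mul0r.
  by rewrite (eqP (le_ni : n - i == 0)%N) [vfield _]lsum0 mulr0.
have -> : peval true (D e n) = peval true ((adser 0 e * flow) n)
    - peval true ((flow * cst (inconst e)) n).
  by rewrite compD compN; apply: raddfB.
rewrite peval_mul cst_mulr pevalM peval_inconst peval1_wser_chen.
rewrite big_ord_recl big1 => [|i _]; last by rewrite !peval1_wser_chen mul0r.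
rewrite !peval1_wser_chen subn0 addr0.
by case: n {IHn} => [|n]; rewrite ?mulr1 ?mul1r ?mulr0 ?mul0r subrr.
Qed.

(** Splits off the last, nonempty piece [v]: the commutators along all [v] make up [Ad_y], and
    subtracting the constant removes the empty [v]. *)
Lemma adserS_dsum j c :
  adser j.+1 c = dsum (fun p => \sum_(u <- comps p) cst (inpoly (kappa k j u))
    * (adser 0 (foldl ad_op c u) - cst (inconst (foldl ad_op c u)))).
Proof.
apply: seriesP => n; rewrite dsumE.
(* The value 0 at the empty [v] admits the cut at the end of [w], which [big_comps_split]
   includes. *)
pose F u v := if v is [::] then 0
  else inpoly (kappa k j u * chen k v) * inconst (foldl ad_op c (u ++ v)).
transitivity (\sum_(w <- comps n) \sum_(i < (size w).+1) F (take i w) (drop i w)).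
  apply: eq_bigr => w _; rewrite big_ord_recr /= drop_size addr0.
  rewrite raddf_sum mulr_suml; apply: eq_bigr => i _; rewrite /F cat_take_drop.
  by have := ltn_ord i; rewrite -subn_gt0 -size_drop; case: (drop i w).
rewrite big_comps_split; apply: eq_bigr => p _.
rewrite series_sum; apply: eq_bigr => u _.
rewrite cst_mull compD compN; case: (n - p)%N => [|m].
  by rewrite wser_chen0 subrr mulr0 comps0 big_seq1.
rewrite subr0 /= !big_compsS.
transitivity (\sum_(i < m.+1) inpoly (kappa k j u) * \sum_(v <- comps (m - i))
    inpoly (chen k (i.+1 :: v)) * inconst (foldl ad_op (foldl ad_op c u) (i.+1 :: v))).
  apply: eq_bigr => i _.
  transitivity (\sum_(v <- comps (m - i)) inpoly (kappa k j u) *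
    (inpoly (chen k (i.+1 :: v)) * inconst (foldl ad_op (foldl ad_op c u) (i.+1 :: v)))).
    by apply: eq_bigr => v _; rewrite /F foldl_cat rmorphM mulrA.
  by rewrite mulr_sumr.
by rewrite mulr_sumr.
Qed.

Lemma adser_dsum j c :
  adser j c = dsum (fun p => \sum_(u <- comps p) cst (inpoly (kappa k j u))
    * cst (inconst (foldl ad_op c u))).
Proof.
apply: seriesP => n; rewrite dsumE.
have E p m : (\sum_(u <- comps p) cst (inpoly (kappa k j u))
    * cst (inconst (foldl ad_op c u))) m
  = if m is 0 then adser j c p else 0.
  rewrite series_sum; under eq_bigr do rewrite cst_mull.
  by case: m => [|m] //; rewrite big1 // => u _; rewrite mulr0.
rewrite big_ord_recr E /= subnn [X in _ = X + _]big1 ?add0r // => p _.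
by rewrite E -(subnSK (ltn_ord p)).
Qed.

(** One more application of [Ad_y - 1], multiplied by y on the right to avoid an inverse. *)
Lemma adserS_flow j c :
  adser j.+1 c * flow = flow * adser j c - adser j c * flow.
Proof.
rewrite adserS_dsum [adser j c]adser_dsum dsum_mull !dsum_mulr -dsumB.
apply: eq_dsum => p; rewrite !mulr_suml mulr_sumr -sumrB; apply: eq_bigr => u _.
rewrite -!mulrA mulrBl adser0_flow mulrBr; congr (_ - _).
by rewrite [RHS]mulrA -(cst_inpoly_comm _ flow) mulrA.
Qed.

(** This is [Ad_y (Ad_y - 1)^j] applied to [vfield], letter by letter. *)
Definition adfield (j : nat) : series A := lsum (fun i => adser j (g i)).

Lemma adfield0_flow : adfield 0 * flow = flow * vfield.
Proof.
by rewrite lsum_mulr lsum_mull; apply: eq_lsum => i; rewrite adser0_flow.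
Qed.

Lemma adfieldS_flow j :
  adfield j.+1 * flow = flow * adfield j - adfield j * flow.
Proof.
rewrite lsum_mull !lsum_mulr -lsumB; apply: eq_lsum => i.
by rewrite adserS_flow.
Qed.

(** A word of weight [n] has at most [n] letters, too few for [j] nonempty pieces. *)
Lemma vanish_below_adser j c : vanish_below j (adser j c).
Proof.
move=> n lt_nj; rewrite /= big_seq big1 // => w; rewrite mem_comps => /andP[/eqP sw w0].
rewrite kappa_eq0 ?raddf0 ?mul0r // (leq_ltn_trans _ lt_nj) // -sw.
elim: w w0 {sw} => //= a w IHw /andP[a0 /IHw]; rewrite -add1n.
exact: leq_add.
Qed.

Lemma vanish_below_lsum N F :
  (forall i, vanish_below N (F i)) -> vanish_below N.+1 (lsum F).
Proof.
move=> H [|n] lt_n; first exact: lsum0.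
rewrite lsumS big1 // => i _; rewrite H ?mulr0 //.
by rewrite (leq_ltn_trans (leq_subr _ _)).
Qed.

Lemma vanish_below_adfield j : vanish_below j.+1 (adfield j).
Proof. by apply: vanish_below_lsum => i; apply: vanish_below_adser. Qed.

Lemma vanish_below_flow1 : vanish_below 1 (flow - 1).
Proof. by move=> [|n] // _; rewrite compD compN wser_chen0 rmorph1 subrr. Qed.


End SeriesCalculus.

(** * The derivative of the logarithm *)

Section LogDerivative.
Variables (k : fieldType) (char0 : [pchar k] =i pred0) (A : algType k).
Variables (g : nat -> A) (K : nat).
Local Notation inpoly := (inpoly A).
Local Notation y := (flow g).
Local Notation u := (flow g - 1).
Local Notation ya := (flow g * vfield g).

(** Both [ad_moment p] and the sum over [m] of [two_sided_term m p] are the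
    integral over [0, 1] of [p x] times the solution [z_x] of
    [(1 - x) z_x y + x y z_x = y a], expanded respectively in powers of [x] and
    in the monomials [u^i (y a) u^j]. *)
Definition ad_moment (p : {poly k}) : series A :=
  \sum_(j < K.+1) unitint (p * (- 'X) ^+ j) *: adfield g j.

Definition two_sided_term (m : nat) (p : {poly k}) : series A :=
  (-1) ^+ m *: \sum_(i < m.+1)
     ('C(m, i)%:R * unitint (p * 'X^i * (1 - 'X) ^+ (m - i)))
       *: (u ^+ i * ya * u ^+ (m - i)).

(** With [y = 1 + u] the equation of [z_x] reads [z + (1 - x) z u + x u z = y a]. The series of
    [(-x)^j] times [adfield j] solves it by telescoping; the truncation at [K] leaves the last
    term. *)
Lemma ad_moment_rec p :
  ad_moment p + ad_moment ((1 - 'X) * p) * u + u * ad_moment ('X * p)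
  = unitint p *: ya + unitint ('X * p * (- 'X) ^+ K) *: (adfield g K.+1 * y).
Proof.
have E1 : ad_moment ((1 - 'X) * p) = ad_moment p - ad_moment ('X * p).
  rewrite /ad_moment -sumrB; apply: eq_bigr => j _.
  by rewrite mulrBl mul1r mulrBl raddfB scalerBl.
have E2 : ad_moment p * y = unitint p *: ya
    - (y * ad_moment ('X * p) - ad_moment ('X * p) * y)
    + unitint ('X * p * (- 'X) ^+ K) *: (adfield g K.+1 * y).
  rewrite {1}/ad_moment mulr_suml big_ord_recl /= expr0 mulr1 -scalerAl.
  rewrite adfield0_flow // -addrA; congr (_ + _).
  have -> : y * ad_moment ('X * p) - ad_moment ('X * p) * y
    = \sum_(j < K.+1) unitint ('X * p * (- 'X) ^+ j) *: (adfield g j.+1 * y).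
    rewrite /ad_moment mulr_sumr mulr_suml -sumrB; apply: eq_bigr => j _.
    by rewrite -scalerAr -scalerAl -scalerBr adfieldS_flow.
  rewrite big_ord_recr /= opprD addrNK -sumrN; apply: eq_bigr => j _.
  rewrite -scalerAl -scaleNr -raddfN /=; congr (unitint _ *: _).
  by rewrite exprS mulNr mulrN mulrA [p * 'X]mulrC.
rewrite E1 [_ * u]mulrBr mulr1 [u * _]mulrBl mul1r.
have -> (X Y Z W : series A) : X + (Z - (X - Y)) + (W - Y) = Z + W.
  rewrite opprB [Z + _]addrC !addrA [X + Y]addrC addrK.
  by rewrite -[Y + Z + W]addrA addrAC subrr add0r.
rewrite mulrBl E2 opprB -[LHS]addrA [- _ + _]addrC -[X in _ + X]opprB.
by rewrite addrAC addrK.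
Qed.

Lemma two_sided_term0 p : two_sided_term 0 p = unitint p *: ya.
Proof.
rewrite /two_sided_term big_ord1 /= !expr0 scale1r mul1r !mulr1 bin0.
by rewrite mul1r.
Qed.

(** Pascal's rule: the new factor [u] goes to the right with [1 - 'X] or to the left with ['X]. *)
Lemma two_sided_termS m p :
  two_sided_term m.+1 p
  = - (two_sided_term m ((1 - 'X) * p) * u + u * two_sided_term m ('X * p)).
Proof.
pose G i j := unitint (p * 'X^i * (1 - 'X) ^+ j) *: (u ^+ i * ya * u ^+ j).
have TE n q : two_sided_term n q = (-1) ^+ n *: \sum_(i < n.+1) 'C(n, i)%:R *:
   (unitint (q * 'X^i * (1 - 'X) ^+ (n - i)) *: (u ^+ i * ya * u ^+ (n - i))).
  by congr (_ *: _); apply: eq_bigr => i _; rewrite scalerA.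
have -> : two_sided_term m ((1 - 'X) * p) * u
    = (-1) ^+ m *: \sum_(i < m.+1) 'C(m, i)%:R *: G i (m.+1 - i)%N.
  rewrite TE -scalerAl mulr_suml; congr (_ *: _); apply: eq_bigr => i _.
  rewrite -!scalerAl /G subSn ?leq_ord // -[_ * u ^+ _ * u]mulrA -exprSr.
  congr (_ *: (unitint _ *: _)); rewrite (exprS (1 - 'X : {poly k}) (m - i)).
  by rewrite -!mulrA mulrCA; congr (_ * _); rewrite mulrCA.
have -> : u * two_sided_term m ('X * p)
    = (-1) ^+ m *: \sum_(i < m.+1) 'C(m, i)%:R *: G i.+1 (m - i)%N.
  rewrite TE -scalerAr mulr_sumr; congr (_ *: _); apply: eq_bigr => i _.
  rewrite -!scalerAr /G (exprS u) !mulrA.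
  by congr (_ *: (unitint _ *: _)); rewrite exprS -!mulrA mulrCA.
rewrite -scalerDr TE exprS mulN1r scaleNr; congr (- (_ *: _)).
rewrite -[LHS]/(\sum_(i < m.+2) 'C(m.+1, i)%:R *: G i (m.+1 - i)%N).
rewrite big_ord_recl /= [in RHS]big_ord_recl /= -addrA !bin0; congr (_ + _).
transitivity (\sum_(i < m.+1) ('C(m, i.+1)%:R *: G i.+1 (m - i)%N
   + 'C(m, i)%:R *: G i.+1 (m - i)%N)).
  by apply: eq_bigr => i _; rewrite /bump /= add1n subSS binS natrD scalerDl.
rewrite big_split /=; congr (_ + _).
by rewrite big_ord_recr /= bin_small // scale0r addr0.
Qed.

Lemma vanish_below_two_sided m p : vanish_below m (two_sided_term m p).
Proof.
apply: vanish_belowZ; apply: vanish_below_sum => i _; apply: vanish_belowZ.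
rewrite -[m in vanish_below m](subnKC (leq_ord i)).
have Hu : vanish_below 1 u by apply: vanish_below_flow1.
apply: vanish_belowM; last exact: vanish_belowX.
by have := vanish_belowM (vanish_belowX (j := i) Hu) (@vanish_below0 _ _ ya); rewrite addn0.
Qed.

(** Both sides obey the same recursion up to remainders that vanish in weights up to [K]. In the
    difference every other term has a factor [u], which has no weight 0 component, so induction on
    the weight applies, for all [p] at once. *)
Lemma ad_moment_two_sided p n : (n <= K)%N ->
  ad_moment p n = (\sum_(m < K.+1) two_sided_term m p) n.
Proof.
pose T p := \sum_(m < K.+1) two_sided_term m p.
have recT q : T q + T ((1 - 'X) * q) * u + u * T ('X * q)
    = unitint q *: ya - two_sided_term K.+1 q.
  rewrite -addrA; apply: (addIr (two_sided_term K.+1 q)); rewrite subrK addrAC.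
  rewrite -[T q + _]/(\sum_(m < K.+1) _ + _) -(big_ord_recr K.+1 (fun m => two_sided_term m q)).
  rewrite big_ord_recl two_sided_term0 -addrA -[RHS]addr0; congr (_ + _).
  rewrite mulr_suml mulr_sumr -!big_split big1 // => m _.
  by rewrite -[LHS]/(two_sided_term m.+1 q + (_ + _)) two_sided_termS addNr.
move=> le_nK; apply/eqP; rewrite -subr_eq0 -compN -compD -/(T p); apply/eqP.
have {le_nK} : (n < K.+1)%N by [].
elim/ltn_ind: n p => n IHn p lt_nK.
have -> : ad_moment p - T p = - ((ad_moment ((1 - 'X) * p) - T ((1 - 'X) * p)) * u
   + u * (ad_moment ('X * p) - T ('X * p)))
   + (unitint ('X * p * (- 'X) ^+ K) *: (adfield g K.+1 * y) + two_sided_term K.+1 p).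
  rewrite [(_ - _) * u]mulrBl [u * (_ - _)]mulrBr; move: (ad_moment_rec p) (recT p).
  move: (ad_moment p) (ad_moment _ * _) (_ * ad_moment _) (T p) (T _ * _) (_ * T _).
  move=> a b c a' b' c'; set E := _ *: (adfield _ _ * _); move: E (unitint p *: ya) => E P.
  move=> e1 e2; have e : (a - a') + ((b - b') + (c - c')) = E + two_sided_term K.+1 p.
    transitivity ((a + b + c) - (a' + b' + c')).
      by rewrite 2!opprD [RHS]addrACA [a + b + (_ + _)]addrACA -[RHS]addrA.
    by rewrite e1 e2 opprB [P + E]addrC -addrA [P + _]addrC subrK.
  by rewrite -e [RHS]addrC addrK.
rewrite compD compN compD compD compZ.
have Hz := vanish_belowM (vanish_below_adfield g (j := K.+1)) (@vanish_below0 _ _ y).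
rewrite Hz ?scaler0 ?add0r; last by rewrite addn0 ltnW.
rewrite (vanish_below_two_sided _ lt_nK) addr0.
have Hu : vanish_below 1 u by apply: vanish_below_flow1.
rewrite series_mulE series_mul_rev.
have Z q v : vanish_below 1 v -> \sum_(i < n.+1) (ad_moment q - T q) i * v (n - i)%N = 0.
  move=> Hv; apply: big1 => i _; case: (ltnP i n) => [lt_in|le_ni].
    by rewrite IHn ?mul0r // (ltn_trans lt_in).
  by rewrite (eqP (le_ni : n - i == 0)%N) Hv ?mulr0.
have Z' q v : vanish_below 1 v -> \sum_(i < n.+1) v (n - i)%N * (ad_moment q - T q) i = 0.
  move=> Hv; apply: big1 => i _; case: (ltnP i n) => [lt_in|le_ni].
    by rewrite IHn ?mulr0 // (ltn_trans lt_in).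
  by rewrite (eqP (le_ni : n - i == 0)%N) Hv ?mul0r.
by rewrite Z // Z' // addr0 oppr0.
Qed.

(** At [p = 1] the Beta integral cancels the binomial coefficient and leaves [1 / (m+1)]. *)
Lemma two_sided_term1 m :
  two_sided_term m 1
  = ((-1) ^+ m / m.+1%:R) *: \sum_(i < m.+1) u ^+ i * ya * u ^+ (m - i).
Proof.
rewrite /two_sided_term -[RHS]scalerA; congr (_ *: _).
rewrite scaler_sumr; apply: eq_bigr => i _; congr (_ *: _); rewrite mul1r unitint_beta //.
rewrite subnKC ?leq_ord // invfM mulrCA mulfV ?mulr1 //.
by have /pcharf0P -> := char0; rewrite -lt0n bin_gt0 leq_ord.
Qed.

(** A truncation of log y: the omitted powers of [u] start in weight [K + 2]. *)
Definition log_flow : series A :=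
  \sum_(j < K.+1) ((-1) ^+ j / j.+1%:R) *: u ^+ j.+1.

Lemma dser_log_flow : dser log_flow = - \sum_(m < K.+1) two_sided_term m 1.
Proof.
have du : dser u = - ya.
  by rewrite raddfB /= dser_flow // -[1](_ : cst (inconst 1) = _) ?dser_cst_inconst ?subr0 //;
     apply: seriesP => -[|n].
rewrite /log_flow raddf_sum -sumrN; apply: eq_bigr => m _.
rewrite two_sided_term1 -scalerN -sumrN [LHS]linearZ; congr (_ *: _).
rewrite [LHS]dser_exp; apply: eq_bigr => i _.
by rewrite du mulrN mulNr.
Qed.

Lemma pevalZ (c : bool) (e : k) (p : polyalg A) : peval c (e *: p) = e *: peval c p.
Proof. exact: linearZ. Qed.

Lemma pderivZ (e : k) (p : polyalg A) : pderiv (e *: p) = e *: pderiv p.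
Proof. exact: linearZ. Qed.

Lemma peval1_exp_flow j n : peval true ((u ^+ j.+1) n) = 0.
Proof.
have one i : peval true ((1 : series A) i) = if i is 0 then 1 else 0.
  by case: i => [|i]; [exact: (peval_inconst true (1 : A)) | exact: raddf0].
have u1 i : peval true (u i) = 0.
  rewrite compD compN; transitivity (peval true (flow g i) - peval true ((1 : series A) i)).
    exact: raddfB.
  by rewrite one peval1_wser_chen subrr.
by rewrite exprS peval_mul big1 // => i _; rewrite u1 mul0r.
Qed.

Lemma log_flowE n : (n < K)%N ->
  peval false (log_flow n.+1)
  = \sum_(i < n.+1) \sum_(w <- comps (n - i))
     (\sum_(j < K.+1) ((-1) ^+ j / j.+1%:R) * unitint ('X^i * kappa k j w))
       *: foldl (ad_op g) (g i.+1) w.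
Proof.
move=> lt_nK.
(* The commutator expansion of [- (log y)'], integrated from the variable to 1 so that [P] vanishes
   at 1. *)
pose P : polyalg A := \sum_(i < n.+1) \sum_(w <- comps (n - i)) \sum_(j < K.+1)
  ((-1) ^+ j / j.+1%:R) *:
    (inpoly (tailint ('X^i * kappa k j w)) * inconst (foldl (ad_op g) (g i.+1) w)).
suff -> : log_flow n.+1 = P.
  rewrite /P raddf_sum; apply: eq_bigr => i _; rewrite raddf_sum; apply: eq_bigr => w _.
  rewrite raddf_sum scaler_suml; apply: eq_bigr => j _.
  rewrite [LHS]pevalZ -scalerA; congr (_ *: _).
  by rewrite [LHS]pevalM peval_inpoly peval_inconst mulr_algl.
apply/eqP; rewrite -subr_eq0; apply/eqP; apply: (pderiv0_peval1_eq0 char0); last first.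
  have L1 : peval true (log_flow n.+1) = 0.
    rewrite /log_flow series_sum raddf_sum big1 // => j _.
    by rewrite -[LHS]/(peval true (_ *: _)) pevalZ peval1_exp_flow scaler0.
  have P1 : peval true P = 0.
    rewrite /P raddf_sum big1 // => i _; rewrite raddf_sum big1 // => w _.
    rewrite raddf_sum big1 // => j _; rewrite [LHS]pevalZ pevalM peval_inpoly.
    by rewrite tailint1 scale0r mul0r scaler0.
  transitivity (peval true (log_flow n.+1) - peval true P); first exact: raddfB.
  by rewrite L1 P1 subrr.
pose Q : polyalg A := \sum_(i < n.+1) \sum_(w <- comps (n - i)) \sum_(j < K.+1)
  ((-1) ^+ j / j.+1%:R) *:
    (inpoly ('X^i) * (inpoly (kappa k j w) * inconst (foldl (ad_op g) (g i.+1) w))).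
have dP : pderiv P = - Q.
  rewrite /P /Q raddf_sum -sumrN; apply: eq_bigr => i _.
  rewrite raddf_sum -sumrN; apply: eq_bigr => w _.
  rewrite raddf_sum -sumrN; apply: eq_bigr => j _.
  rewrite [LHS]pderivZ pderivM pderiv_inpoly pderiv_inconst mulr0 addr0.
  by rewrite deriv_tailint // raddfN /= rmorphM mulNr scalerN -mulrA.
have dL : pderiv (log_flow n.+1) = - Q.
  rewrite -[pderiv (log_flow n.+1)]/(dser log_flow n.+1) dser_log_flow compN.
  (* The two-sided form of the derivative is exchanged for the commutator form; the weight [n.+1] is
     at most [K]. *)
  rewrite -ad_moment_two_sided // /ad_moment series_sum; congr (- _).
  transitivity (\sum_(j < K.+1) \sum_(i < n.+1) \sum_(w <- comps (n - i))
    ((-1) ^+ j / j.+1%:R) *: (inpoly ('X^i) * (inpoly (kappa k j w)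
       * inconst (foldl (ad_op g) (g i.+1) w)))).
    apply: eq_bigr => j _; rewrite compZ lsumS scaler_sumr.
    have -> : unitint (1 * (- 'X) ^+ j) = (-1) ^+ j / j.+1%:R :> k.
      by rewrite mul1r -scaleN1r exprZn linearZ /= unitintXn.
    by apply: eq_bigr => i _; rewrite /= mulr_sumr scaler_sumr.
  rewrite exchange_big; apply: eq_bigr => i _.
  by rewrite exchange_big.
transitivity (pderiv (log_flow n.+1) - pderiv P); first exact: raddfB.
by rewrite dL dP subrr.
Qed.

End LogDerivative.

(** * The initial value and the theorem *)

Lemma fsbig_list (T : choiceType) (V : nmodType) (D : set T) (r : seq T) (F : T -> V) :
  uniq r -> (forall i, i \in r -> D i) -> (forall i, D i -> i \notin r -> F i = 0) ->
  \sum_(i \in D) F i = \sum_(i <- r) F i.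
Proof.
move=> ur rD F0; rewrite [RHS]fsbig_seq //; apply/esym/fsbig_widen => [i /rD //|i].
by move=> [Di /negP ri]; apply: F0.
Qed.

Lemma fsbig_pos (V : nmodType) N (F : nat -> V) :
  (forall j, (N < j)%N -> F j = 0) ->
  \sum_(j \in [set j | (0 < j)%N]) F j = \sum_(j < N) F j.+1.
Proof.
move=> F0; rewrite (@fsbig_list _ _ _ (iota 1 N)) ?iota_uniq //.
- rewrite -(addn0 1%N) iotaDl big_map -[in iota 0 N](subn0 N).
  by rewrite -[iota 0 _]/(index_iota 0 N) big_mkord.
- by move=> i; rewrite mem_iota => /andP[].
- by move=> i /= i0; rewrite mem_iota i0 /= add1n ltnS -ltnNge => /F0.
Qed.

Section FlowAtZero.
Variables (k : fieldType) (char0 : [pchar k] =i pred0) (A : algType k).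
Variables (g F : nat -> A) (F0 : F 0%N = 1)
  (FS : forall n, n.+1%:R *: F n.+1 = \sum_(i < n.+1) g i.+1 * F (n - i)%N).

(** The product of [flow] with the series [Fs] is constant. At 1 its component is [F n], since
    [flow] is 1 there; at 0 it is that of [flow], since only [F 0] survives in [Fs]. *)
Lemma peval0_flow n : peval false (flow g n) = F n.
Proof.
pose Fs : series A := ser (fun n => inpoly A 'X^n * inconst (F n)).
have dFs : dser Fs = vfield g * Fs.
  apply: seriesP => -[|m]; rewrite lsum_mulr.
    by rewrite lsum0 /= pderivM pderiv_inpoly pderiv_inconst derivC raddf0 mul0r mulr0 addr0.
  rewrite lsumS /= pderivM pderiv_inpoly pderiv_inconst mulr0 addr0 derivXn /=.
  rewrite raddfMn mulrnAl -mulrnAr -raddfMn -scaler_nat FS raddf_sum mulr_sumr.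
  apply: eq_bigr => i _; rewrite -[X in _ = _ * X]/((cst _ * Fs) _) cst_mull /=.
  rewrite rmorphM /= [RHS]mulrA.
  have -> : 'X^m = 'X^i * 'X^(m - i) :> {poly k} by rewrite -exprD subnKC ?leq_ord.
  rewrite rmorphM /= -!mulrA; congr (_ * _).
  by rewrite mulrA inpoly_comm -mulrA.
have d0 m : pderiv ((flow g * Fs) m) = 0.
  rewrite -[LHS]/(dser (flow g * Fs) m) dserM dser_flow // dFs mulNr mulrA.
  by rewrite addNr.
have : peval false ((flow g * Fs) n) = peval true ((flow g * Fs) n).
  set p := (flow g * Fs) n; have dp : pderiv p = 0 by apply: d0.
  have /eqP : p - inconst (peval true p) = 0.
    apply: (pderiv0_peval1_eq0 char0).
      transitivity (pderiv p - pderiv (inconst (peval true p))); first exact: raddfB.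
      by rewrite dp pderiv_inconst subrr.
    transitivity (peval true p - peval true (inconst (peval true p))); first exact: raddfB.
    by rewrite peval_inconst subrr.
  by rewrite subr_eq0 => /eqP e; rewrite {1}e peval_inconst.
have Fse c i : peval c (Fs i) = (c%:R ^+ i) *: F i.
  by rewrite [LHS]pevalM peval_inpoly peval_inconst hornerXn mulr_algl.
rewrite !peval_mul big_ord_recr big1 ?add0r => [|i _]; last first.
  by rewrite Fse -(subnSK (ltn_ord i)) exprS mul0r scale0r mulr0.
rewrite big_ord_recl big1 ?addr0 => [|i _]; last first.
  by rewrite [peval true (flow _ _)]peval1_wser_chen mul0r.
rewrite [peval true (flow _ _)]peval1_wser_chen !Fse subnn subn0 expr0 expr1n.
by rewrite !scale1r F0 mulr1 mul1r [X in X = _]add0r => ->.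
Qed.

(** The two sides live in different completions, so the powers are compared component by component
    through the multiplicative evaluation at 0. *)
Lemma peval0_log_flow (G : nat -> A -> Prop) (H : completion G) K n :
  H 0%N = 0 -> (forall n, H n.+1 = F n.+1) ->
  peval false (log_flow g K n)
  = \sum_(j < K.+1) ((-1) ^+ j / j.+1%:R) *: (H ^+ j.+1) n.
Proof.
move=> H0 HS; rewrite /log_flow series_sum raddf_sum; apply: eq_bigr => j _.
rewrite -[LHS]/(peval false (_ *: _)) pevalZ; congr (_ *: _).
have one i : peval false ((1 : series A) i) = (1 : completion G) i.
  by case: i => [|i]; [exact: (peval_inconst false (1 : A)) | exact: raddf0].
have u0 i : peval false ((flow g - 1) i) = H i.
  rewrite compD compN.
  transitivity (peval false (flow g i) - peval false ((1 : series A) i)).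
    exact: raddfB.
  by rewrite one peval0_flow comp1; case: i => [|i]; rewrite ?F0 ?subrr ?H0 ?subr0 ?HS.
elim: (j.+1) n => [|m IHm] n; first by rewrite !expr0.
rewrite !exprS peval_mul compM; apply: eq_bigr => i _.
by rewrite u0 IHm.
Qed.

End FlowAtZero.

(** * Components of beta, of its powers and of xi in the enveloping algebra *)

Section Xi.
Variables (k : fieldType) (char0 : [pchar k] =i pred0).

(** The brackets in [xi] stay in degree 0, where the Koszul sign is 1 and a bracket becomes a plain
    commutator. *)
Lemma L_deg0_br (x y : L k) : L_deg 0 x -> L_deg 0 y -> L_deg 0 (lbr x y).
Proof.
move=> [x' hx ->] [y' hy ->]; exists (preL_br x' y'); last exact: toL_br.
move=> w; rewrite -mcoeff_neq0 => nz.
have [u ux [v vy ->]] :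
    exists2 u, u \in msupp x' & exists2 v, v \in msupp y' & w = LBr u v.
  apply: contrapT => H; case/eqP: nz.
  rewrite /preL_br /malg_op raddf_sum big_seq big1 // => u ux.
  rewrite raddf_sum big_seq big1 // => v vy; rewrite /= mcoeffU.
  by case: eqP => // E; case: H; exists u => //; exists v.
by rewrite /= (hx _ ux) (hy _ vy).
Qed.

Lemma L_deg0Z c (x : L k) : L_deg 0 x -> L_deg 0 (c *: x).
Proof.
move=> [y hy ->]; exists (c *: y); last by rewrite linearZ.
by move=> w /(fsubsetP (msuppZ_le _ _)) /hy.
Qed.

Definition U_f (i : nat) : U k := iota_U (L_f k i).

Lemma iota_U0 : iota_U (0 : L k) = 0.
Proof.
have := @iota_env_linear _ _ (@lbr k) (@L_deg k) (-1) 0 0.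
by rewrite scaler0 addr0 scaleN1r addNr.
Qed.

Lemma U_fE i : U_f i = i%:R *: iota_U (L_b k i).
Proof.
have := @iota_env_linear _ _ (@lbr k) (@L_deg k) i%:R (L_b k i) 0.
by rewrite [X in _ = _ + X]iota_U0 !addr0.
Qed.

Lemma iota_ad_f i w : iota_U (ad_f k (i :: w)) = foldl (ad_op U_f) (U_f i) w.
Proof.
have dL j : L_deg 0 (L_f k j) by apply/L_deg0Z/L_b_deg.
rewrite /= /U_f; move: (L_f k i) (dL i); elim: w => [|j w IHw] x dx //=.
rewrite IHw; last exact: L_deg0_br.
by rewrite [iota_U (lbr _ _)](iota_env_br _ (dL j) dx) expr0z scale1r.
Qed.

Local Notation prec_sum := (hat_sum [set j : nat | (0 < j)%N] (prec_pow (beta k))).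

Lemma betaE n : beta k n = iota_U (L_b k n).
Proof.
case: n => [|n]; first by rewrite beta0 /L_b raddf0 iota_U0.
rewrite [LHS](@fsbig_list _ _ _ [:: n.+1]) //= ?big_seq1 ?eqxx //.
  by move=> i; rewrite inE => /eqP ->.
by move=> i _; rewrite inE eq_sym => /negbTE ->.
Qed.

Lemma prec_sumE N n : (n <= N)%N -> prec_sum n = \sum_(j < N) prec_pow (beta k) j.+1 n.
Proof.
move=> le_nN; rewrite [LHS](@fsbig_pos _ N) // => j lt_Nj.
by apply: prec_pow_lt; [apply: beta0|apply: leq_ltn_trans lt_Nj].
Qed.

Lemma prec_sum0 : prec_sum 0%N = 0.
Proof. by rewrite (@prec_sumE 0) // big_ord0. Qed.

(** The total weight clears the denominator in [hat_prec], and the numerator [i] turns [b_i] into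
    [f_i]. *)
Lemma prec_pow_betaS j n :
  n.+1%:R *: prec_pow (beta k) j.+2 n.+1
  = \sum_(i < n.+1) U_f i.+1 * prec_pow (beta k) j.+1 (n - i)%N.
Proof.
have -> : prec_pow (beta k) j.+2 n.+1 = \sum_(i < n.+2)
    (i%:R / (i + (n.+1 - i))%:R) *: (beta k i * prec_pow (beta k) j.+1 (n.+1 - i)%N).
  by [].
rewrite big_ord_recl mul0r scale0r add0r scaler_sumr; apply: eq_bigr => i _.
rewrite -[LHS]/(n.+1%:R *: ((i.+1%:R / (i.+1 + (n.+1 - i.+1))%:R)
   *: (beta k i.+1 * prec_pow (beta k) j.+1 (n.+1 - i.+1)%N))).
rewrite subSS addSn subnKC ?leq_ord // scalerA mulrCA.
by rewrite mulfV ?succ_natf_neq0 // mulr1 U_fE betaE scalerAl.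
Qed.

(** Summing over the powers yields the recursion required of [F]. The first power, beta itself,
    accounts for the summand 1. *)
Lemma prec_sumS n :
  n.+1%:R *: prec_sum n.+1 = \sum_(i < n.+1) U_f i.+1 * (1 + prec_sum : hatU k) (n - i)%N.
Proof.
rewrite (@prec_sumE n.+1) // big_ord_recl scalerDr.
have -> : n.+1%:R *: \sum_(j < n) prec_pow (beta k) (lift ord0 j).+1 n.+1
  = \sum_(j < n) \sum_(i < n.+1) U_f i.+1 * prec_pow (beta k) j.+1 (n - i)%N.
  by rewrite scaler_sumr; apply: eq_bigr => j _; exact: prec_pow_betaS.
rewrite exchange_big.
transitivity (\sum_(i < n.+1) (U_f i.+1 * (n - i == 0)%N%:R
  + \sum_(j < n) U_f i.+1 * prec_pow (beta k) j.+1 (n - i)%N)); last first.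
  by apply: eq_bigr => i _; rewrite compD comp1 mulrDr (@prec_sumE n) ?leq_subr // mulr_sumr.
rewrite big_split; congr (_ + _).
transitivity (U_f n.+1); first by rewrite U_fE -betaE.
rewrite big_ord_recr big1 => [|i _]; last by rewrite -(subnSK (ltn_ord i)) mulr0.
by rewrite [RHS]add0r subnn eqxx mulr1.
Qed.

(** By [xi_coef_kappa], the contribution of a nonempty word [w] of positive letters to [xi], once
    [K] is at least its length. *)
Definition ad_term K (w : seq nat) : U k :=
  if w is i :: w' then
    (\sum_(j < K) ((-1) ^+ j / j.+1%:R) * unitint ('X^(i.-1) * kappa k j w'))
      *: foldl (ad_op U_f) (U_f i) w'
  else 0.

Lemma xiE n K : (n <= K)%N -> xi k n = \sum_(w <- comps n) ad_term K w.
Proof.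
move=> le_nK.
have size_comps w : w \in comps n -> (size w <= n)%N.
  rewrite mem_comps => /andP[/eqP <-].
  by elim: w => //= a w IHw /andP[a0 /IHw]; rewrite -add1n; apply: leq_add.
have inner m : (hat_sum (@pos_tuples m) (@xi_term k m)) n
    = \sum_(w <- comps n | size w == m.+1) ad_term K w.
  (* The compositions of [n] with [m.+1] parts, as tuples; all other positive tuples have another
     weight. *)
  pose r : seq (m.+1.-tuple nat) := pmap insub (comps n).
  have mem_r (t : m.+1.-tuple nat) : (t \in r) = (val t \in comps n).
    by rewrite mem_pmap_sub.
  rewrite [LHS](@fsbig_list _ _ _ r) ?pmap_sub_uniq ?uniq_comps //.
  - rewrite -[RHS]big_filter.
    have -> : [seq w <- comps n | size w == m.+1] = map val r.
      by rewrite (pmap_filter (@insubK _ _ _)); apply: eq_filter => w; rewrite isSome_insub.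
    rewrite big_map big_seq [RHS]big_seq; apply: eq_bigr => t.
    rewrite mem_r => tc; have := size_comps _ tc; rewrite size_tuple => lt_mn.
    move: tc; rewrite mem_comps => /andP[/eqP st t0].
    case E: (tval t) => [|i w]; first by have := size_tuple t; rewrite E.
    rewrite /xi_term compZ /= st eqxx (xi_coef_kappa char0 E t0 (leq_trans lt_mn le_nK)).
    have -> : ad_term K (val t) = ad_term K (i :: w) by rewrite -E.
    by rewrite /ad_term -iota_ad_f -E.
  - move=> t; rewrite mem_r mem_comps => /andP[_ /allP t0] j.
    by apply: t0; apply: mem_tnth.
  - move=> t post; rewrite mem_r mem_comps => nt; apply: xi_term_eq0.
    apply: contraNneq nt => ->; rewrite eqxx /=; apply/allP => _ /tnthP[j ->].
    exact: post.
rewrite [LHS](@fsbig_list _ _ _ (iota 0 n)) ?iota_uniq //; last first.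
  move=> m _; rewrite mem_iota add0n /= -leqNgt => le_nm; rewrite [LHS]inner.
  rewrite big_seq_cond big1 // => w /andP[/size_comps le_w /eqP sw].
  by move: le_w; rewrite sw ltnNge le_nm.
under eq_bigr => m _ do rewrite inner.
rewrite (exchange_big_dep predT) //= big_seq [RHS]big_seq; apply: eq_bigr => w wc.
have := size_comps _ wc; case: w {wc} => [|i w] /= lt_w.
  by rewrite big1.
rewrite -big_filter (_ : [seq _ <- _ | _] = [:: size w]) ?big_seq1 //.
rewrite -(filter_pred1_uniq (iota_uniq 0 n)) ?mem_iota //.
by apply: eq_filter => m; rewrite /= eqSS eq_sym.
Qed.

End Xi.

Theorem mainTheorem5 (k : fieldType) (char0 : [pchar k] =i pred0) :
  xi k = hat_log1p (hat_sum [set j : nat | (0 < j)%N] (prec_pow (beta k))).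
Proof.
set H := hat_sum _ _; have H0 : H 0%N = 0 by apply: prec_sum0.
apply: completionP => n.
(* The power [j] of [H] vanishes below weight [j], so [n.+2] powers suffice; the same bound is used
   for [xi]. *)
have -> : hat_log1p H n = \sum_(j < n.+2) ((-1) ^+ j / j.+1%:R) *: (H ^+ j.+1) n.
  rewrite [LHS](@fsbig_pos _ n.+2) // => j lt_nj.
  by rewrite compZ exp_lt ?scaler0 // ltnW // ltnW.
rewrite (xiE char0 (leqW (leqnSn n))).
case: n => [|n].
  rewrite comps0 big_seq1 big1 // => j _.
  by rewrite exp_lt ?scaler0.
(* Now [F] is the value of the flow of the [f_i] at 0, and both sides become the same sum over
   compositions. *)
pose F := fun m => (1 + H : hatU k) m.
have F0 : F 0%N = 1 by rewrite /F compD comp1 H0 addr0.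
have FS m : m.+1%:R *: F m.+1 = \sum_(i < m.+1) U_f k i.+1 * F (m - i)%N.
  by rewrite -prec_sumS // /F compD comp1 add0r.
rewrite -(peval0_log_flow char0 F0 FS) //; last by move=> m; rewrite /F compD comp1 add0r.
rewrite log_flowE // big_compsS; apply: eq_bigr => i _.
by apply: eq_bigr => w _.
Qed.
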